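(* Let $Q$ be the quadratic form on $\Lambda^+$ given by $Q(v)=\mathrm{wt}(v)/2 \bmod 2$. Let $\Omega_A$ be the set of maximally separated subsets of $V=\mathbb{F}_2^8/U$, let $\Omega_A^+$ be the set of elements of $\Omega_A$ that are contained in $\Lambda^+$, and let $\Omega_A^-$ be the set of elements of $\Omega_A$ that are contained in $\Lambda^-$. Then: (i) The elements of $\Omega_A$ are the cosets in $V$ of the $30$ maximal totally singular subspaces of $\Lambda^+$ with respect to $Q$ (that is, maximal among subspaces on which $Q$ vanishes). In particular, every element of $\Omega_A$ is a set of size $8$. (ii) We have $|\Omega_A|=480$, $|\Omega_A^+|=|\Omega_A^-|=240$, and $\Omega_A$ is the disjoint union of $\Omega_A^+$ and $\Omega_A^-$. (iii) The function $\lambda^-$ is a bijection from the set $\Omega_{240}$ of packings of $PG(3,2)$ to $\Omega_A^-$. (iv) The function $\lambda^+$ (applied elementwise to subsets of $\Psi$) is a bijection from the set $\Omega_\Psi$ of orthogonal $8$-tuples in $\Psi$ to $\Omega_A^+$. (v) The involution $t_8:V\to V$ given by $t_8(v+U)=v+\varepsilon_8+U$ induces a bijection $$(\lambda^-)^{-1}\circ t_8\circ \lambda^+ : \Omega_\Psi\to\Omega_{240}$$ from the set of $240$ orthogonal $8$-tuples in $\Psi$ to the set of packings of $PG(3,2)$.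
   Context: Write $\mathbf{n}=\{1,\dots,n\}$. The space $V$. Let $\mathbb{F}_2^8$ have basis $\varepsilon_1,\dots,\varepsilon_8$, let $U$ be the span of the all-ones vector, and let $V=\mathbb{F}_2^8/U$. For $A\subseteq\mathbf{8}$ let $v_A\in V$ be the coset of $\sum_{i\in A}\varepsilon_i$, so $v_A=v_{\mathbf{8}\setminus A}$; write $v_{ijk}$ for $v_{\{i,j,k\}}$, $v_l$ for $v_{\{l\}}$, etc. Elements of $V$ correspond to unordered partitions $\{A\mid B\}$ of $\mathbf{8}$ into at most two parts. $\Lambda^+\subset V$ is the $6$-dimensional subspace of all $v_A$ with $|A|$ even, and $\Lambda^-=V\setminus\Lambda^+$ is its other coset, the set of all $v_A$ with $|A|$ odd. $\mathrm{wt}$ denotes Hamming weight of either representative in $\mathbb{F}_2^8$; $Q$ is well defined and satisfies $Q(v_A)=1$ if $|A|\in\{2,6\}$ and $Q(v_A)=0$ if $|A|\in\{0,4,8\}$. Two elements $v_1+U$, $v_2+U$ of $V$ are separated if the Hamming distance between $v_1$ and $v_2$ is $4$. A subset of $V$ is maximally separated if it has maximal cardinality among the subsets of $V$ in which any two distinct elements are separated. Packings. A spread of $PG(3,2)$ is a partition of its $15$ points into five lines; a packing is a partition of its $35$ lines into seven spreads. The set of packings is $\Omega_{240}$. Identify the lines with the $3$-element subsets of $\mathbf{7}$ by a fixed bijection under which two distinct lines meet if and only if the corresponding $3$-subsets have exactly one common element. For a $4$-subset $T$ of $\mathbf{8}$ let $\iota(T)$ be the $3$-subset of $\mathbf{7}$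 obtained by removing $8$ from whichever of $T$, $\mathbf{8}\setminus T$ contains $8$. The $56$ spreads are the sets $\sigma(A)=\{\iota(T): A\subset T\subset\mathbf{8},\ |T|=4\}$ for $A$ a $3$-subset of $\mathbf{8}$. An $\mathbf{8}$-labelled Fano plane is a set of seven $3$-subsets (''triples'') of $\mathbf{8}$ that are the lines of a Fano plane on seven of the eight labels; the unused label is its basepoint. It is known that $x\mapsto\{\sigma(A):A\in x\}$ is a bijection from the $240$ $\mathbf{8}$-labelled Fano planes to the packings, and packings are identified with $\mathbf{8}$-labelled Fano planes in this way. For such an $x$ with basepoint $l$, $\lambda^-(x)\subset\Lambda^-$ is the set consisting of the seven elements $v_{ijk}$ for the triples $\{i,j,k\}$ of $x$ together with $v_l$. Roots. Let $e_1,\dots,e_8$ be the standard orthonormal basis of $\mathbb{R}^8$. The roots of type $E_8$ are the $112$ vectors $\pm e_i\pm e_j$ ($i<j$, independent signs) and the $128$ vectors $\sum_{i=1}^8\pm\frac12 e_i$ with evenly many minus signs. The simple roots are $\alpha_1=\frac12(e_1+e_8)-\frac12(e_2+\cdots+e_7)$, $\alpha_2=e_1+e_2$, and $\alpha_i=e_{i-1}-e_{i-2}$ for $3\le i\le 8$. $\Psi$ is the set of $64$ roots in which $\alpha_1$ appears with coefficient $1$ when the root is written as a combination of simple roots; these are the roots $\frac12 e_8+\sum_{i=1}^7\pm\frac12 e_i$ with evenly many minus signs. $\Omega_\Psi$ is the set of $8$-element subsets of $\Psi$ whose elements are pairwise orthogonal for the usual scalar product. For $\alpha\in\Psi$, $\lambda^+(\alpha)\in\Lambda^+$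 is the element corresponding to the partition $\{A\mid B\}$ of $\mathbf{8}$ with $8\in A$ and $\alpha=\sum_{i\in A}\frac12 e_i-\sum_{j\in B}\frac12 e_j$ (i.e. $v_A=v_B$). *)

(* Defs.v *)
From HB Require Import structures.
From mathcomp Require Import all_boot all_order all_algebra finmap.
From mathcomp Require Import classical_sets functions cardinality reals.
(* Restores the finite-set meaning of names that classical_sets shadows. *)
From mathcomp Require Import finset.

Set Implicit Arguments.
Unset Strict Implicit.
Unset Printing Implicit Defensive.

Import Order.TTheory GRing.Theory Num.Theory.
Local Open Scope ring_scope.
Local Open Scope quotient_scope.

(* The labels 1, ..., 8 are the elements 0, ..., 7 of 'I_8. *)
Definition label (i : nat) : 'I_8 := inord i.-1.

Definition U : {vspace 'rV['F_2]_8} := <[const_mx 1]>%VS.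

Definition V : Type := Quotient.quot U.

HB.instance Definition _ := GRing.Zmodule.on V.
HB.instance Definition _ := Quotient.on V.
HB.instance Definition _ : isCountable V := CanIsCountable (@reprK _ V).
HB.instance Definition _ : isFinite V := CanIsFinite (@reprK _ V).

Definition piV (u : 'rV['F_2]_8) : V := \pi_V u.

Lemma eq_piV (u v : 'rV['F_2]_8) : (piV u == piV v) = (u - v \in U).
Proof. by rewrite /piV -Quotient.idealrBE. Qed.

Lemma piVD : {morph piV : u v / u + v}.
Proof. exact: (@raddfD _ (Quotient.quot U) \pi). Qed.

Lemma piV_repr (x : V) : piV (repr x) = x.
Proof. exact: reprK. Qed.

Definition scaleV (a : 'F_2) (x : V) : V := piV (a *: repr x).

Lemma scaleV_piV (a : 'F_2) (u : 'rV['F_2]_8) :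
  scaleV a (piV u) = piV (a *: u).
Proof.
apply/eqP; rewrite eq_piV -scalerBr rpredZ // -eq_piV; apply/eqP.
exact: piV_repr.
Qed.

Fact scaleVA a b x : scaleV a (scaleV b x) = scaleV (a * b) x.
Proof. by rewrite -[x]piV_repr !scaleV_piV scalerA. Qed.

Fact scaleV1 : left_id 1 scaleV.
Proof. by move=> x; rewrite -[x]piV_repr scaleV_piV scale1r. Qed.

Fact scaleVDr : right_distributive scaleV +%R.
Proof.
move=> a x y; rewrite -[x]piV_repr -[y]piV_repr -piVD !scaleV_piV.
by rewrite scalerDr piVD.
Qed.

Fact scaleVDl x : {morph scaleV^~ x : a b / a + b}.
Proof. by move=> a b; rewrite -[x]piV_repr !scaleV_piV scalerDl piVD. Qed.

HB.instance Definition _ :=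
  GRing.Zmodule_isLmodule.Build 'F_2 V scaleVA scaleV1 scaleVDr scaleVDl.

Definition indic (A : {set 'I_8}) : 'rV['F_2]_8 := \row_i (i \in A)%:R.

Definition v_ (A : {set 'I_8}) : V := piV (indic A).

Definition LambdaP : {set V} := [set v_ A | A : {set 'I_8} & ~~ odd #|A|].
Definition LambdaM : {set V} := ~: LambdaP.

Definition wt (u : 'rV['F_2]_8) : nat := #|[set i | u 0 i != 0]|.
Definition hdist (u v : 'rV['F_2]_8) : nat := #|[set i | u 0 i != v 0 i]|.

(* Separation, Q and t8 below are computed on chosen representatives; the
   lemmas separated_piV, Q_piV and t8_piV show the choice is irrelevant. *)
Definition separated (x y : V) : bool := hdist (repr x) (repr y) == 4.

Definition Q (x : V) : 'F_2 := ((wt (repr x))./2)%:R.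

Lemma repr_piV (u : 'rV['F_2]_8) :
  repr (piV u) = u \/ repr (piV u) = u + const_mx 1.
Proof.
have : repr (piV u) - u \in U by rewrite -eq_piV piV_repr.
case/vlineP=> a /(canRL (subrK u)) ->.
have: a \in [:: 0; 1] by case: a => -[|[|]].
rewrite !inE => /orP[] /eqP ->; first by left; rewrite scale0r add0r.
by right; rewrite scale1r addrC.
Qed.

Lemma hdistC (u v : 'rV['F_2]_8) : hdist u v = hdist v u.
Proof. by apply: eq_card => i; rewrite !inE eq_sym. Qed.

Lemma hdist1 (u v : 'rV['F_2]_8) :
  hdist (u + const_mx 1) v = (8 - hdist u v)%N.
Proof.
rewrite /hdist cardsCs card_ord; congr (8 - _)%N; apply: eq_card => i.
rewrite !inE negbK mxE [const_mx 1 _ _]mxE.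
by move: (u 0 i) (v 0 i) => [[|[|//]] ?] [[|[|//]] ?].
Qed.

Lemma hdist_le8 (u v : 'rV['F_2]_8) : (hdist u v <= 8)%N.
Proof. by rewrite -[leqRHS](card_ord 8) max_card. Qed.

Lemma separated_piV (u v : 'rV['F_2]_8) :
  separated (piV u) (piV v) = (hdist u v == 4).
Proof.
rewrite /separated; case: (repr_piV u) => ->; case: (repr_piV v) => -> //.
- rewrite hdistC hdist1 hdistC.
  by move: (hdist u v) (hdist_le8 u v); do 9?case=> //.
- by rewrite hdist1; move: (hdist u v) (hdist_le8 u v); do 9?case=> //.
- rewrite hdist1 hdistC hdist1 hdistC.
  by move: (hdist u v) (hdist_le8 u v); do 9?case=> //.
Qed.

Lemma wtE (u : 'rV['F_2]_8) : wt u = hdist u 0.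
Proof. by apply: eq_card => i; rewrite !inE mxE. Qed.

Lemma Q_piV (u : 'rV['F_2]_8) :
  ~~ odd (wt u) -> Q (piV u) = ((wt u)./2)%:R.
Proof.
rewrite /Q; case: (repr_piV u) => -> //; rewrite !wtE hdist1.
by move: (hdist u 0) (hdist_le8 u 0); do 9?case=> //; move=> *; apply/val_inj.
Qed.

(* Q is a quadratic form on LambdaP, with the standard polar form. *)
Lemma Q_polar (u v : 'rV['F_2]_8) : ~~ odd (wt u) -> ~~ odd (wt v) ->
  Q (piV u + piV v) = Q (piV u) + Q (piV v) + \sum_i u 0 i * v 0 i.
Proof.
move=> eu ev; pose k := (\sum_i ((u 0%R i != 0%R) && (v 0%R i != 0%R)))%N.
have wt_sum w : wt w = (\sum_i (w 0%R i != 0%R))%N.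
  by rewrite /wt -sum1dep_card big_mkcond; apply: eq_bigr => i _; case: ifP.
have wtD : (wt (u + v) + k.*2 = wt u + wt v)%N.
  rewrite !wt_sum -muln2 big_distrl -!big_split; apply: eq_bigr => i _ /=.
  by rewrite mxE; move: (u 0 i) (v 0 i) => [[|[|//]] ?] [[|[|//]] ?].
have -> : \sum_i u 0 i * v 0 i = k%:R.
  rewrite /k natr_sum; apply: eq_bigr => i _.
  move: (u 0 i) (v 0 i) => [[|[|//]] ?] [[|[|//]] ?]; exact/val_inj.
have euv : ~~ odd (wt (u + v)).
  move/(congr1 odd): wtD.
  by rewrite !oddD odd_double (negPf eu) (negPf ev) addbF => ->.
have half : ((wt u)./2 + (wt v)./2 = (wt (u + v))./2 + k)%N.
  have := congr1 half wtD; rewrite !halfD odd_double (negPf eu) andbF /=.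
  by rewrite !add0n doubleK => ->.
rewrite -piVD !Q_piV // -natrD half natrD -addrA -natrD addnn -mul2n natrM.
by rewrite [2%:R](_ : _ = 0) ?mul0r ?addr0 //; apply/val_inj.
Qed.

Definition pairwise_separated (S : {set V}) : bool :=
  [forall x in S, forall y in S, (x != y) ==> separated x y].

Definition maximally_separated (S : {set V}) : bool :=
  pairwise_separated S &&
  [forall T : {set V}, pairwise_separated T ==> (#|T| <= #|S|)%N].

Definition Omega_A : {set {set V}} := [set S | maximally_separated S].
Definition Omega_AP : {set {set V}} := [set S in Omega_A | S \subset LambdaP].
Definition Omega_AM : {set {set V}} := [set S in Omega_A | S \subset LambdaM].

Definition is_subspace (W : {set V}) : bool :=
  (0 \in W) &&
  [forall a : 'F_2, forall x in W, forall y in W, a *: x + y \in W].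

Lemma is_subspaceP (W : {set V}) : reflect (submod_closed W) (is_subspace W).
Proof.
apply: (iffP andP) => -[W0 Wl]; split=> //.
  move=> a x y xW yW.
  by move/forallP/(_ a)/forall_inP/(_ x xW)/forall_inP/(_ y yW): Wl.
by apply/forallP=> a; apply/forall_inP=> x xW; apply/forall_inP=> y; apply: Wl.
Qed.

Definition totally_singular (W : {set V}) : bool :=
  [&& is_subspace W, W \subset LambdaP & [forall x in W, Q x == 0]].

Definition max_totally_singular : {set {set V}} :=
  [set W | maxset totally_singular W].

Definition cosetV (x : V) (W : {set V}) : {set V} := [set x + w | w in W].

Definition t8 (x : V) : V := x + v_ [set label 8].

Lemma t8_piV (u : 'rV['F_2]_8) : t8 (piV u) = piV (u + delta_mx 0 (label 8)).
Proof.
rewrite /t8 /v_ -piVD; congr (piV (_ + _)).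
by apply/rowP=> i; rewrite !mxE eqxx inE.
Qed.

Lemma t8K : involutive t8.
Proof.
move=> x; rewrite /t8 -addrA -piVD (_ : indic _ + indic _ = 0).
  by rewrite -[x]piV_repr -piVD addr0.
by apply/rowP=> i; rewrite !mxE; case: (i \in _); apply/val_inj.
Qed.

(* A point of PG(3,2) is represented by the unique nonzero vector on it, and a
   line by the set of its points. *)
Definition pg_points : {set 'rV['F_2]_4} := [set p | p != 0].

Definition line_through (p q : 'rV['F_2]_4) : {set 'rV['F_2]_4} :=
  [set r in pg_points | r \in <<[:: p; q]>>%VS].

Definition pg_lines : {set {set 'rV['F_2]_4}} :=
  [set line_through p q | p in pg_points, q in pg_points & p != q].

Definition spreads : {set {set {set 'rV['F_2]_4}}} :=
  [set S : {set {set 'rV['F_2]_4}} |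
    [&& S \subset pg_lines, #|S| == 5 & partition S pg_points]].

Definition packings : {set {set {set {set 'rV['F_2]_4}}}} :=
  [set P : {set {set {set 'rV['F_2]_4}}} |
    [&& P \subset spreads, #|P| == 7 & partition P pg_lines]].

(* The 3-subsets of {1, ..., 7}, as subsets of {1, ..., 8} that avoid 8. *)
Definition triples7 : {set {set 'I_8}} :=
  [set t : {set 'I_8} | (#|t| == 3) && (label 8 \notin t)].

Definition line_identification
    (phi : {set 'rV['F_2]_4} -> {set 'I_8}) : Prop :=
  set_bij [set` pg_lines]%classic [set` triples7]%classic phi /\
  {in pg_lines &, forall L M, L != M ->
     (L :&: M != set0) = (#|phi L :&: phi M| == 1%N)}.

Definition iota8 (T : {set 'I_8}) : {set 'I_8} :=
  (if label 8 \in T then T else ~: T) :\ label 8.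

Definition sigma (A : {set 'I_8}) : {set {set 'I_8}} :=
  [set iota8 T | T : {set 'I_8} & (A \subset T) && (#|T| == 4)].

Definition sigma_lines (phi : {set 'rV['F_2]_4} -> {set 'I_8})
    (A : {set 'I_8}) : {set {set 'rV['F_2]_4}} :=
  [set L in pg_lines | phi L \in sigma A].

(* A Fano plane on the points cover x: the projective plane axioms, with seven
   points and seven lines of three points each. *)
Definition fano_planes : {set {set {set 'I_8}}} :=
  [set x : {set {set 'I_8}} |
    [&& #|x| == 7, [forall t in x, #|t| == 3], #|cover x| == 7,
        [forall i in cover x, forall j in cover x,
           (i != j) ==> (#|[set t in x | (i \in t) && (j \in t)]| == 1%N)]
      & [forall s in x, forall t in x,
           (s != t) ==> (#|s :&: t| == 1%N)]]].

(* ~: cover x consists of the basepoint of x only. *)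
Definition lambdaM_fano (x : {set {set 'I_8}}) : {set V} :=
  [set v_ t | t in x] :|: [set v_ [set l] | l in ~: cover x].

Definition packing_of_fano (phi : {set 'rV['F_2]_4} -> {set 'I_8})
    (x : {set {set 'I_8}}) : {set {set {set 'rV['F_2]_4}}} :=
  [set sigma_lines phi A | A in x].

(* The inverse of the bijection from labelled Fano planes to packings. *)
Definition fano_of_packing (phi : {set 'rV['F_2]_4} -> {set 'I_8}) :
    {set {set {set 'rV['F_2]_4}}} -> {set {set 'I_8}} :=
  'pinv_(fun=> set0) [set` fano_planes]%classic (packing_of_fano phi).

Definition lambdaM (phi : {set 'rV['F_2]_4} -> {set 'I_8})
    (P : {set {set {set 'rV['F_2]_4}}}) : {set V} :=
  lambdaM_fano (fano_of_packing phi P).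

Definition lambdaM_inv (phi : {set 'rV['F_2]_4} -> {set 'I_8}) :
    {set V} -> {set {set {set 'rV['F_2]_4}}} :=
  'pinv_(fun=> set0) [set` packings]%classic (lambdaM phi).

Section Roots.
Variable R : realType.

Definition e (i : nat) : 'rV[R]_8 := delta_mx 0 (label i).

Definition dot (a b : 'rV[R]_8) : R := \sum_i a 0 i * b 0 i.

(* N is the set of coordinates carrying a minus sign. *)
Definition E8_root (a : 'rV[R]_8) : bool :=
  [exists i : 'I_8, exists j : 'I_8, exists s : bool, exists t : bool,
     (i < j)%N &&
     (a == (-1) ^+ s *: delta_mx 0 i + (-1) ^+ t *: delta_mx 0 j)] ||
  [exists N : {set 'I_8}, ~~ odd #|N| &&
     (a == \sum_i ((-1) ^+ (i \in N) / 2) *: delta_mx 0 i)].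

Definition simple_roots : 8.-tuple 'rV[R]_8 :=
  [tuple 2^-1 *: (e 1 + e 8) - 2^-1 *: (\sum_(2 <= i < 8) e i);
         e 1 + e 2; e 2 - e 1; e 3 - e 2; e 4 - e 3; e 5 - e 4; e 6 - e 5;
         e 7 - e 6].

(* coord simple_roots 0 is the coefficient of alpha_1. *)
Definition Psi : {pred 'rV[R]_8} :=
  [pred a | E8_root a && (coord simple_roots 0 a == 1)].

Definition Omega_Psi : set {fset 'rV[R]_8} :=
  fun S => [/\ {subset S <= Psi}, #|` S| = 8
             & {in S &, forall a b, a != b -> dot a b = 0}].

(* The labels carrying a positive coordinate; see lambdaP_half. *)
Definition lambdaP (a : 'rV[R]_8) : V := v_ [set i | 0 < a 0 i].

Definition lambdaP_set (S : {fset 'rV[R]_8}) : {set V} :=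
  [set lambdaP (val a) | a : S].

Lemma lambdaP_half (A : {set 'I_8}) :
  lambdaP (\sum_(i in A) 2^-1 *: delta_mx 0 i
           - \sum_(j in ~: A) 2^-1 *: delta_mx 0 j) = v_ A.
Proof.
have coefE (B : {set 'I_8}) (i : 'I_8) :
    (\sum_(j in B) 2^-1 *: delta_mx 0 j : 'rV[R]_8) 0 i
      = if i \in B then 2^-1 else 0.
  rewrite summxE; case: ifP => [iB|iB].
    rewrite (bigD1 i) //= !mxE !eqxx mulr1 big1 ?addr0 // => j /andP[_ ji].
    by rewrite !mxE eqxx eq_sym (negPf ji) mulr0.
  rewrite big1 // => j jB; rewrite !mxE eqxx; case: eqP => [ij|_].
    by rewrite ij jB in iB.
  by rewrite mulr0.
congr v_; apply/setP=> i; rewrite inE [X in 0 < X]mxE [X in 0 < _ + X]mxE.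
rewrite !coefE inE.
by case: (i \in A); rewrite ?subr0 ?sub0r ?oppr_gt0 ?invr_gt0 ?invr_lt0
  ?ltr0n // ltNge ler0n.
Qed.

End Roots.

(* Main.v *)
Require Import Defs.
From HB Require Import structures.
From mathcomp Require Import all_boot all_order all_algebra finmap.
From mathcomp Require Import classical_sets functions cardinality reals.
From mathcomp Require Import finset.
From mathcomp Require Import zify lra.

(** Separation of x and y in V depends only on x + y: it says that x + y is
    a partition of the eight labels into two 4-subsets, equivalently a
    nonzero vector of [LambdaP] on which [Q] vanishes. A separated set
    containing 0 therefore consists of singular vectors with singular
    pairwise sums; the polar form of [Q] vanishes on it and it lies in a
    totally singular subspace ([separated_sub_coset]). So the maximally
    separated sets are the cosets of the largest totally singular subspaces.

    The size of such a subspace W is bounded by comparison with the eight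
    odd vectors v_l. Two of them differ by a vector of weight 2, which is
    not singular, so the cosets v_l + W are disjoint subsets of the
    64-element set [LambdaM], and W has at most 8 elements ([ts_card_le8]).
    A smaller totally singular subspace always extends, and counting ordered
    bases in two ways gives 35 * 18 * 8 = 30 * (7 * 6 * 4), that is, 30
    subspaces ([card_max_ts]). Each has eight cosets in [LambdaP] and eight
    in [LambdaM], whence 240 + 240 = 480.

    When W has 8 elements the cosets v_l + W fill [LambdaM], so a maximally
    separated set of odd vectors contains exactly one v_l, and its seven
    other members are triples. Two triples are separated when they have one
    common label, and the coset structure supplies the line through any two labels
    ([pointed_line]); hence these sets are exactly the labelled Fano planes
    with their basepoints. On the other side, adding the last label to the
    triple of a line turns lines of PG(3,2) into singular vectors in such a
    way that two lines meet when their vectors are orthogonal. A spread is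
    then a set of five pairwise nonorthogonal singular vectors, and these
    are the five 4-subsets containing a 3-subset A, up to complement
    ([spread_sigma_lines]). The spreads of A and B are disjoint exactly when
    A and B have one common label, so a packing is a system of seven triples
    meeting pairwise in one label, which is again a labelled Fano plane
    ([packing_of_fano_bij]).

    Finally the elements of [Psi] are the vectors with coordinates 1/2 and
    -1/2 whose set of positive coordinates is even and contains the last
    label ([PsiP]). That set represents an element of [LambdaP] uniquely,
    and two such roots are orthogonal when they agree in four coordinates,
    which is separation. Translation by v_8 exchanges [LambdaP] and
    [LambdaM] and preserves separation, so the last bijection is a composite
    of the previous ones. *)

Set Implicit Arguments.
Unset Strict Implicit.
Unset Printing Implicit Defensive.

Import Order.TTheory GRing.Theory Num.Theory.
Local Open Scope ring_scope.

(** * Subsets of the eight labels up to complement *)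

Lemma F2P (a : 'F_2) : a = 0 \/ a = 1.
Proof. by case: a => -[|[|//]] ?; [left|right]; apply/val_inj. Qed.

(** Addition in F_2^8, read on supports. *)
Definition symd (A B : {set 'I_8}) : {set 'I_8} :=
  [set i | (i \in A) (+) (i \in B)].

Lemma v_D A B : v_ A + v_ B = v_ (symd A B).
Proof.
rewrite /v_ -piVD; congr piV; apply/rowP=> i; rewrite !mxE inE.
by case: (i \in A); case: (i \in B); apply/val_inj.
Qed.

Lemma indic_setC A : indic (~: A) = indic A + const_mx 1.
Proof.
apply/rowP=> i; rewrite !mxE inE.
by case: (i \in A); apply/val_inj.
Qed.

Lemma indic_inj : injective indic.
Proof.
move=> A B /rowP eqAB; apply/setP=> i; move: (eqAB i); rewrite !mxE.
by case: (i \in A); case: (i \in B).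
Qed.

Lemma indic_surj u : exists A, u = indic A.
Proof.
exists [set i | u 0 i != 0]; apply/rowP=> i; rewrite !mxE inE.
by case: (F2P (u 0 i)) => ->; rewrite ?eqxx ?oner_eq0.
Qed.

Lemma v_surj x : exists A, x = v_ A.
Proof.
by have [A eA] := indic_surj (repr x); exists A; rewrite /v_ -eA piV_repr.
Qed.

Lemma eq_v A B : (v_ A == v_ B) = (A == B) || (A == ~: B).
Proof.
apply/eqP/orP => [eqAB|[/eqP->//|/eqP->]].
  have [rA rB] := (repr_piV (indic A), repr_piV (indic B)).
  rewrite -/(v_ A) eqAB in rA; rewrite -/(v_ B) in rB.
  have twice1 (u : 'rV['F_2]_8) : u + const_mx 1 + const_mx 1 = u.
    apply/rowP=> i; rewrite !mxE -addrA (_ : 1 + 1 = 0) ?addr0 //.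
    exact/val_inj.
  case: rA rB => -> [] E.
  - by left; apply/eqP/indic_inj.
  - by right; apply/eqP/indic_inj; rewrite indic_setC.
  - by right; apply/eqP/indic_inj; rewrite indic_setC -E twice1.
  - by left; apply/eqP/indic_inj/(addIr _ E).
rewrite /v_; apply/eqP; rewrite eq_piV indic_setC addrC addKr.
exact: memv_line.
Qed.

Lemma v_setC A : v_ (~: A) = v_ A.
Proof. by apply/eqP; rewrite eq_v eqxx orbT. Qed.

Lemma hdist_indic A B : hdist (indic A) (indic B) = #|symd A B|.
Proof.
apply: eq_card => i; rewrite !inE !mxE.
by case: (i \in A); case: (i \in B).
Qed.

Lemma separated_v A B : separated (v_ A) (v_ B) = (#|symd A B| == 4).
Proof. by rewrite separated_piV hdist_indic. Qed.

Lemma card_setC8 (A : {set 'I_8}) : (#|~: A| = 8 - #|A|)%N.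
Proof. by rewrite cardsCs setCK card_ord. Qed.

Lemma card_le8 (A : {set 'I_8}) : (#|A| <= 8)%N.
Proof. by rewrite -[leqRHS](card_ord 8) max_card. Qed.

Lemma v_even A : (v_ A \in LambdaP) = ~~ odd #|A|.
Proof.
apply/imsetP/idP => [[B]|oA]; last by exists A; rewrite ?inE.
rewrite inE => oB /eqP; rewrite eq_v => /orP[/eqP->//|/eqP->].
by rewrite card_setC8 oddB ?card_le8.
Qed.

Lemma Q_v (A : {set 'I_8}) : ~~ odd #|A| -> Q (v_ A) = (#|A|./2)%:R.
Proof.
have wA : wt (indic A) = #|A|.
  by apply: eq_card => i; rewrite !inE mxE; case: (i \in A).
by move=> oA; rewrite Q_piV ?wA.
Qed.

Lemma v_set0 : v_ set0 = 0.
Proof.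
have -> : v_ set0 = piV 0 by congr piV; apply/rowP=> i; rewrite !mxE inE.
by apply: (addrI (piV 0)); rewrite -piVD !addr0.
Qed.

(** V has exponent 2, so a subtraction is written as an addition throughout and
    the next lemmas cancel repeated summands. *)
Lemma addVV (x : V) : x + x = 0.
Proof.
have [A ->] := v_surj x; rewrite v_D -v_set0; congr v_.
by apply/setP=> i; rewrite !inE addbb.
Qed.

Lemma addVK (x y : V) : x + (x + y) = y.
Proof. by rewrite addrA addVV add0r. Qed.

Lemma addKV (x y : V) : x + y + y = x.
Proof. by rewrite -addrA addVV addr0. Qed.

Lemma addV_eq (x y z : V) : x + y = z -> x = z + y.
Proof. by move=> <-; rewrite addKV. Qed.

Lemma addV_eq0 (x y : V) : (x + y == 0) = (x == y).
Proof. by rewrite -(inj_eq (addIr y)) addKV add0r. Qed.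

(** * Singular vectors *)

(** The 35 partitions into two parts of size 4. Being separated depends only on
    the sum, so separation is the Cayley graph relation of this set; the same
    set is that of the nonzero vectors of [LambdaP] where [Q] vanishes, which is
    how separated sets and totally singular subspaces meet. *)
Definition sing (x : V) : bool := separated x 0.

Lemma sing_v A : sing (v_ A) = (#|A| == 4).
Proof.
rewrite /sing -v_set0 separated_v; congr (_ == _); apply: eq_card => i.
by rewrite !inE addbF.
Qed.

Lemma separatedE x y : separated x y = sing (x + y).
Proof.
have [A ->] := v_surj x; have [B ->] := v_surj y.
by rewrite v_D sing_v separated_v.
Qed.

Lemma sing0 : sing 0 = false.
Proof. by rewrite -v_set0 sing_v cards0. Qed.

Lemma sing_even x : sing x -> x \in LambdaP.
Proof. by have [A ->] := v_surj x; rewrite sing_v v_even => /eqP->. Qed.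

Lemma singE x : x \in LambdaP -> x != 0 -> sing x = (Q x == 0).
Proof.
have [A ->] := v_surj x; rewrite v_even -v_set0 eq_v => oA.
rewrite Q_v // sing_v setC0 -cards_eq0 eqEcard subsetT cardsT card_ord /=.
by move: (#|A|) oA (card_le8 A); do 9?[case=> //].
Qed.

Lemma Q0 : Q 0 = 0.
Proof. by rewrite -v_set0 Q_v cards0. Qed.

Lemma Q_sing x : sing x -> Q x = 0.
Proof.
move=> sx; apply/eqP; rewrite -singE ?sing_even //.
by apply: contraTneq sx => ->; rewrite sing0.
Qed.

Lemma card_symd (A B : {set 'I_8}) :
  (#|symd A B| = #|A| + #|B| - #|A :&: B|.*2)%N.
Proof.
have -> : symd A B = (A :\: B) :|: (B :\: A).
  by apply/setP=> i; rewrite !inE; case: (i \in A); case: (i \in B).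
rewrite cardsU (_ : _ :&: _ = set0); last first.
  by apply/setP=> i; rewrite !inE; case: (i \in A); case: (i \in B).
rewrite cards0 subn0 !cardsD [B :&: A]setIC -addnn.
have := subset_leq_card (subsetIl A B); have := subset_leq_card (subsetIr A B).
lia.
Qed.

Lemma even_v_add x y :
  (x + y \in LambdaP) = ((x \in LambdaP) == (y \in LambdaP)).
Proof.
have [A ->] := v_surj x; have [B ->] := v_surj y; rewrite v_D !v_even card_symd.
have : (#|A :&: B|.*2 <= #|A| + #|B|)%N.
  have := subset_leq_card (subsetIl A B).
  have := subset_leq_card (subsetIr A B).
  lia.
move=> le2; rewrite oddB // odd_double addbF oddD.
by case: (odd _); case: (odd _).
Qed.

(** A quadratic form has degree 2, so its third difference vanishes. *)
Lemma Q_add3 x y z : x \in LambdaP -> y \in LambdaP -> z \in LambdaP ->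
  Q (x + y + z) = Q (x + y) + Q (x + z) + Q (y + z) + Q x + Q y + Q z.
Proof.
have wtE (A : {set 'I_8}) : wt (indic A) = #|A|.
  by apply: eq_card => i; rewrite !inE mxE; case: (i \in A).
have wtD A B : indic A + indic B = indic (symd A B).
  apply/rowP=> i; rewrite !mxE inE.
  by case: (i \in A); case: (i \in B); apply/val_inj.
have F2D (a : 'F_2) : a + a = 0 by case: (F2P a) => ->; apply/val_inj.
have [A ->] := v_surj x; have [B ->] := v_surj y; have [C ->] := v_surj z.
rewrite !v_even => oA oB oC.
have oAB : ~~ odd #|symd A B|.
  by move: (even_v_add (v_ A) (v_ B)); rewrite v_D !v_even oA oB => ->.
rewrite /v_ -[piV _ + piV _]piVD wtD Q_polar ?wtE // -wtD piVD.
rewrite !Q_polar ?wtE //.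
have -> : \sum_i (indic A + indic B) 0 i * indic C 0 i
  = \sum_i indic A 0 i * indic C 0 i + \sum_i indic B 0 i * indic C 0 i.
  by rewrite -big_split; apply: eq_bigr => i _; rewrite mxE mulrDl.
move: (Q _) (Q _) (Q _) (\sum_i _) (\sum_i _) (\sum_i _) => a b c d e f.
by case: (F2P a) => ->; case: (F2P b) => ->; case: (F2P c) => ->;
   case: (F2P d) => ->; case: (F2P e) => ->; case: (F2P f) => ->; apply/val_inj.
Qed.

(** * Seven-bit coordinates *)

(** The eight elements of [LambdaM] of smallest weight. Two of them differ by a
    pair, which is never singular; all the geometry below is measured against
    this set. *)
Definition points : {set V} := [set v_ [set l] | l : 'I_8].

Lemma points_v (A : {set 'I_8}) : (v_ A \in points) = (#|A| \in [:: 1; 7]%N).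
Proof.
rewrite !inE; apply/imsetP/orP => [[l _ /eqP]|].
  by rewrite eq_v => /orP[/eqP->|/eqP->]; rewrite ?card_setC8 cards1; [left|right].
case=> [/cards1P[l ->]|/eqP cA]; first by exists l.
have /cards1P[l El] : #|~: A| == 1%N by rewrite card_setC8 cA.
by exists l => //; rewrite -v_setC El.
Qed.

(** Choosing in each class the representative that avoids the last label
    identifies V with the bit sequences of length 7, on which the finite counts
    below are evaluated. *)
Fixpoint bitseqs n : seq bitseq :=
  if n is n'.+1 then
    [seq true :: s | s <- bitseqs n'] ++ [seq false :: s | s <- bitseqs n']
  else [:: [::]].

Lemma mem_bitseqs n s : (s \in bitseqs n) = (size s == n).
Proof.
elim: n s => [|n IHn] [|b s] //=; rewrite mem_cat.
  by apply/norP; split; apply/mapP => -[].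
have mem_cons c : (b :: s \in [seq c :: t | t <- bitseqs n])
    = (b == c) && (size s == n).
  apply/mapP/andP => [[t]|[/eqP-> sn]]; last by exists s; rewrite // IHn.
  by rewrite IHn => tn [-> ->].
by rewrite !mem_cons eqSS; case: b {mem_cons}; rewrite ?orbF.
Qed.

Lemma bitseqs_uniq n : uniq (bitseqs n).
Proof.
elim: n => //= n IHn.
rewrite cat_uniq !map_inj_uniq ?IHn => [/=|s t []//|s t []//].
by rewrite andbT; apply/hasPn => _ /mapP[s _ ->]; apply/mapP => -[].
Qed.

Definition dec (s : bitseq) : V := v_ [set i : 'I_8 | nth false s i].

Definition xor (s t : bitseq) : bitseq := [seq p.1 (+) p.2 | p <- zip s t].

(** [wt4] and [wt17] are the images of [sing] and of [points]: a set that avoids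
    the last label has weight 7 when its complement is the last label alone. *)
Definition wt4 (s : bitseq) := count id s == 4.
Definition wt17 (s : bitseq) := (count id s == 1) || (count id s == 7).

Lemma size_xor s t : size s = 7 -> size t = 7 -> size (xor s t) = 7.
Proof. by rewrite size_map size_zip => -> ->. Qed.

Lemma decD s t : size s = 7 -> size t = 7 -> dec s + dec t = dec (xor s t).
Proof.
move=> s7 t7; rewrite v_D; congr v_; apply/setP=> i; rewrite !inE.
have [i7|i7] := ltnP i 7.
  by rewrite (nth_map (false, false)) ?nth_zip ?size_zip ?s7 ?t7.
by rewrite !nth_default ?size_xor ?s7 ?t7.
Qed.

Lemma card_bits s : size s = 7 ->
  #|[set i : 'I_8 | nth false s i]| = count id s.
Proof.
move=> s7; rewrite -sum1dep_card big_mkcond /=.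
case: s s7 => [|b0[|b1[|b2[|b3[|b4[|b5[|b6[|]]]]]]]] //= _.
rewrite !big_ord_recl big_ord0 /=.
by case: b0; case: b1; case: b2; case: b3; case: b4; case: b5; case: b6.
Qed.

Lemma sing_dec s : size s = 7 -> sing (dec s) = wt4 s.
Proof. by move=> s7; rewrite sing_v card_bits. Qed.

Lemma points_dec s : size s = 7 -> (dec s \in points) = wt17 s.
Proof. by move=> s7; rewrite points_v card_bits // !inE. Qed.

Lemma even_dec s : size s = 7 -> (dec s \in LambdaP) = ~~ odd (count id s).
Proof. by move=> s7; rewrite v_even card_bits. Qed.

Lemma dec_surj x : exists2 s, size s = 7 & x = dec s.
Proof.
have [A ->] := v_surj x.
wlog A8 : A / ord_max \notin A => [IH|].
  have [A8|/IH//] := boolP (ord_max \in A).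
  by rewrite -v_setC; apply: IH; rewrite inE A8.
exists (mkseq (fun i => inord i \in A) 7); first by rewrite size_mkseq.
congr v_; apply/setP=> i; rewrite inE.
have [i7|i7] := ltnP i 7; first by rewrite nth_mkseq // inord_val.
rewrite nth_default ?size_mkseq //.
have -> : i = ord_max; last exact: negbTE.
by apply/val_inj/eqP; rewrite eqn_leq i7 andbT -ltnS ltn_ord.
Qed.

Lemma dec_inj s t : size s = 7 -> size t = 7 -> dec s = dec t -> s = t.
Proof.
move=> s7 t7 /eqP; rewrite eq_v => /orP[|] /eqP/setP eq_st; last first.
  by move: (eq_st ord_max); rewrite !inE /= !nth_default ?s7 ?t7.
apply: (@eq_from_nth _ false) => [|i]; rewrite s7 ?t7 // => i7.
by move: (eq_st (inord i)); rewrite !inE inordK // ltnW.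
Qed.

Lemma card_dec (p : pred V) (q : pred bitseq) :
    (forall s, size s = 7 -> p (dec s) = q s) ->
  #|[set x | p x]| = count q (bitseqs 7).
Proof.
move: (bitseqs 7) (mem_bitseqs 7) (bitseqs_uniq 7) => b mem_b uniq_b pq.
have mem_dec x : x \in map dec b.
  by have [s s7 ->] := dec_surj x; rewrite map_f // mem_b s7.
have uniq_dec : uniq (map dec b).
  rewrite map_inj_in_uniq // => s t.
  by rewrite !mem_b => /eqP s7 /eqP t7; apply: dec_inj.
have -> : #|[set x | p x]| = #|filter p (map dec b)|.
  by apply: eq_card => x; rewrite inE mem_filter mem_dec andbT.
rewrite (card_uniqP _) ?filter_uniq // size_filter count_map.
by apply: eq_in_count => s; rewrite mem_b => /eqP/pq.
Qed.

Lemma card_V : #|[set: V]| = 128%N.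
Proof.
have <- : #|[set x : V | predT x]| = #|[set: V]|.
  by apply: eq_card => x; rewrite !inE.
by rewrite (@card_dec predT predT).
Qed.

Lemma card_LambdaP : #|LambdaP| = 64%N.
Proof.
have <- : #|[set x | x \in LambdaP]| = #|LambdaP|.
  by apply: eq_card => x; rewrite inE.
by rewrite (card_dec even_dec).
Qed.

(** Counting among the 35 singular vectors only keeps the evaluations below
    small. *)
Definition tetrads : seq bitseq := filter wt4 (bitseqs 7).

Lemma mem_tetrads s : (s \in tetrads) = (size s == 7) && wt4 s.
Proof. by rewrite mem_filter mem_bitseqs andbC. Qed.

Lemma card_sing_dec (p : pred V) (q : pred bitseq) :
    (forall s, size s = 7 -> p (dec s) = q s) ->
  #|[set x | sing x && p x]| = count q tetrads.
Proof.
move=> pq; rewrite (card_dec (q := predI q wt4)) ?count_filter // => s s7 /=.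
by rewrite sing_dec // pq // andbC.
Qed.

Lemma card_sing : #|[set x | sing x]| = 35%N.
Proof. by rewrite (card_dec sing_dec); vm_compute. Qed.

(** With [card_sing3], this counts the ways to enlarge a totally singular
    subspace of dimension 1, then 2. *)
Lemma card_sing2 a : sing a -> #|[set b | sing b && sing (a + b)]| = 18%N.
Proof.
have [s s7 ->] := dec_surj a; rewrite sing_dec // => s4.
rewrite (@card_sing_dec _ (fun t => wt4 (xor s t))) => [|t t7]; last first.
  by rewrite decD // sing_dec ?size_xor.
have /allP/(_ s) : all (fun s => count (fun t => wt4 (xor s t)) tetrads == 18)
    tetrads by vm_compute.
by rewrite mem_tetrads s7 s4 => /(_ isT)/eqP.
Qed.

Lemma card_sing3 a b : sing a -> sing b -> sing (a + b) ->
  #|[set c | sing c && [&& sing (a + c), sing (b + c) & sing (a + b + c)]]|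
    = 8%N.
Proof.
have [s s7 ->] := dec_surj a; have [t t7 ->] := dec_surj b.
rewrite decD // !sing_dec ?size_xor // => s4 t4 st4.
pose q s t u := [&& wt4 (xor s u), wt4 (xor t u) & wt4 (xor (xor s t) u)].
rewrite (@card_sing_dec _ (q s t)) => [|u u7]; last first.
  by rewrite !decD ?size_xor // !sing_dec ?size_xor.
have /allP/(_ s) : all (fun s => all (fun t => count (q s t) tetrads == 8)
    [seq t <- tetrads | wt4 (xor s t)]) tetrads by vm_compute.
rewrite mem_tetrads s7 s4 => /(_ isT)/allP/(_ t).
by rewrite mem_filter mem_tetrads t7 t4 st4 => /(_ isT)/eqP.
Qed.

Definition nonorth (s t : bitseq) := (s != t) && ~~ wt4 (xor s t).

(** For each clique of length [n] of [nonorth] within [cands], some member of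
    [zs] must be a point away from all of its members. Both candidate lists are
    filtered at each level, so that the evaluation is a short tree search. *)
Fixpoint cliques_in_balls n (zs cands : seq bitseq) :=
  if n is n'.+1 then
    all (fun s => cliques_in_balls n' [seq z <- zs | wt17 (xor s z)]
                                      [seq t <- cands | nonorth s t]) cands
  else zs != [::].

Lemma cliques_in_ballsP n zs cands (c : seq bitseq) :
    cliques_in_balls n zs cands -> size c = n -> {subset c <= cands} ->
  pairwise nonorth c -> exists2 z, z \in zs & {in c, forall s, wt17 (xor s z)}.
Proof.
elim: n zs cands c => [|n IHn] zs cands [|s c] //=.
  by case: zs => // z zs _ _ _ _; exists z; rewrite ?mem_head.
move=> /allP ok [cn] sub /andP[/allP sc pc].
have [||z] := IHn _ _ c (ok s _) cn _ pc.
- by apply: sub; rewrite mem_head.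
- by move=> t tc; rewrite mem_filter sc // sub // inE tc orbT.
rewrite mem_filter => /andP[sz zz] cz; exists z => // t.
by rewrite inE => /predU1P[->|/cz].
Qed.

Lemma cliques_in_balls5 : cliques_in_balls 5 (bitseqs 7) tetrads.
Proof. by vm_compute. Qed.

(** Five pairwise nonorthogonal singular vectors are five 4-subsets of which any
    two share three labels, up to complement. Relative to the first one each of
    the others exchanges a label of one part for a label of the other, and two
    such exchanges are compatible only if they share a label; so all have a
    common 3-subset z in one of their parts. Here this is checked by exhaustive
    search. *)
Lemma nonorthogonal_quintuple (a : seq V) :
    size a = 5 -> {in a, forall x, sing x} ->
    pairwise (fun x y => (x != y) && ~~ sing (x + y)) a ->
  exists z, {in a, forall x, x + z \in points}.
Proof.
move=> a5 sa pa.
have [c c7 Ea] : exists2 c, {in c, forall s, size s = 7} & a = map dec c.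
  elim: a {a5 sa pa} => [|x a [c c7 ->]]; first by exists [::].
  have [s s7 ->] := dec_surj x; exists (s :: c) => // t.
  by rewrite inE => /predU1P[->//|/c7].
have c5 : size c = 5 by rewrite -a5 Ea size_map.
have c4 : {subset c <= tetrads}.
  move=> s sc; rewrite mem_tetrads c7 // eqxx /=.
  by rewrite -sing_dec ?c7 // sa // Ea map_f.
have pc : pairwise nonorth c.
  move: pa; rewrite Ea pairwise_map; apply: (sub_in_pairwise (P := mem c)).
    move=> s t sc tc /=; rewrite decD ?c7 // sing_dec ?size_xor ?c7 //.
    by case/andP=> ne nst; apply/andP; split=> //; apply: contraNneq ne => ->.
  exact/allP.
have [z] := cliques_in_ballsP cliques_in_balls5 c5 c4 pc.
rewrite mem_bitseqs => /eqP z7 cz; exists (dec z) => x.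
rewrite Ea => /mapP[s sc ->]; have s7 := c7 s sc.
by rewrite decD // points_dec ?size_xor // cz.
Qed.

(** * Totally singular subspaces *)

Lemma mem_coset (x y : V) (W : {set V}) : (y \in cosetV x W) = (x + y \in W).
Proof.
apply/imsetP/idP => [[w wW ->]|xyW]; first by rewrite addVK.
by exists (x + y); rewrite ?addVK.
Qed.

Lemma card_coset x W : #|cosetV x W| = #|W|.
Proof. exact/card_imset/addrI. Qed.

Definition singular (x : V) : bool := (x == 0) || sing x.

Lemma singular_even x : singular x -> x \in LambdaP.
Proof. by case/predU1P=> [->|/sing_even//]; rewrite -v_set0 v_even cards0. Qed.

Lemma singularE x : singular x = (x \in LambdaP) && (Q x == 0).
Proof.
rewrite /singular; have [->|x0] := eqVneq x 0.
  by rewrite Q0 eqxx andbT singular_even // /singular eqxx.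
apply/idP/andP => [sx|[ex]]; last by rewrite singE.
by rewrite sing_even // Q_sing.
Qed.

(** For vectors with singular pairwise sums the polar form vanishes, so that
    [Q] is additive on them; it is the reason why separated sets generate
    totally singular subspaces. *)
Lemma singular_add3 x y z : singular x -> singular y -> singular z ->
    singular (x + y) -> singular (x + z) -> singular (y + z) ->
  singular (x + y + z).
Proof.
rewrite !singularE => /andP[ex /eqP qx] /andP[ey /eqP qy] /andP[ez /eqP qz].
move=> /andP[exy /eqP qxy] /andP[_ /eqP qxz] /andP[_ /eqP qyz].
rewrite even_v_add exy ez Q_add3 // qx qy qz qxy qxz qyz.
by rewrite !addr0 eqxx.
Qed.

(** Over F_2 a subspace is a subgroup, and singular vectors are even. *)
Lemma tsP (W : {set V}) :
  reflect [/\ 0 \in W, {in W &, forall x y, x + y \in W}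
            & {in W, forall x, singular x}]
          (totally_singular W).
Proof.
apply: (iffP and3P) => [[]|].
  move=> /is_subspaceP[W0 Wl] /fintype.subsetP We /forall_inP Wq.
  split=> // [x y xW yW|x xW]; first by rewrite -[x]scale1r Wl.
  by rewrite singularE We ?Wq.
case=> W0 WD Ws; split.
- apply/is_subspaceP; split=> // a x y xW yW.
  by case: (F2P a) => ->; rewrite ?scale0r ?add0r // scale1r WD.
- by apply/fintype.subsetP=> x /Ws/singular_even.
- by apply/forall_inP=> x /Ws; rewrite singularE => /andP[].
Qed.

Lemma ts_set0 : totally_singular [set 0].
Proof.
apply/tsP; split=> [|x y|x]; rewrite ?inE //.
  by move=> /eqP-> /eqP->; rewrite addr0.
by rewrite /singular => ->.
Qed.

(** The span of [W] and [c] when [W] is a subspace. *)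
Definition grow (c : V) (W : {set V}) : {set V} := W :|: cosetV c W.

Lemma mem_grow c W x : (x \in grow c W) = (x \in W) || (c + x \in W).
Proof. by rewrite inE mem_coset. Qed.

Lemma ts_grow c W : totally_singular W -> {in W, forall w, sing (c + w)} ->
  totally_singular (grow c W) /\ #|grow c W| = (2 * #|W|)%N.
Proof.
case/tsP=> W0 WD Ws cW; split.
  apply/tsP; split=> [|x y|x]; rewrite !mem_grow ?W0 //.
    case/orP=> xW /orP[] yW; first by rewrite (WD x).
    - by rewrite addrCA (WD x (c + y)) ?orbT.
    - by rewrite addrA (WD (c + x)) ?orbT.
    - by rewrite -(addVK c y) addrA [x + c]addrC (WD (c + x)).
  case/orP=> [/Ws//|/cW]; rewrite addVK => sx.
  by rewrite /singular sx orbT.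
rewrite cardsU card_coset addnn -mul2n (_ : _ :&: _ = set0) ?cards0 ?subn0 //.
apply/setP=> x; rewrite !inE mem_coset; apply/negP => /andP[xW cxW].
have cxx : c + x + x \in W by rewrite WD.
by move: (cW c); rewrite addVV sing0 -[c](addKV _ x) cxx => /(_ isT).
Qed.

Lemma sing_points (l m : 'I_8) : sing (v_ [set l] + v_ [set m]) = false.
Proof.
by rewrite v_D sing_v card_symd !cards1; case: #|_ :&: _| => [|[|[]]].
Qed.

Lemma points_even l : (v_ [set l] \in LambdaP) = false.
Proof. by rewrite v_even cards1. Qed.

Lemma point_inj : injective (fun l : 'I_8 => v_ [set l]).
Proof.
move=> l m /eqP; rewrite eq_v => /orP[/eqP/set1_inj//|/eqP eq_lm].
by have := cards1 l; rewrite eq_lm card_setC8 cards1.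
Qed.

Lemma card_LambdaM : #|LambdaM| = 64%N.
Proof.
have := cardsC LambdaP; rewrite card_LambdaP.
have -> : #|Defs_V__canonical__fintype_Finite| = 128%N by rewrite -cardsT card_V.
by rewrite /LambdaM => /eqP; rewrite -[128%N]/(64 + 64)%N eqn_add2l => /eqP.
Qed.

(** The cosets of a totally singular [W] through the eight points are disjoint,
    because two points differ by a nonsingular vector. They fit in [LambdaM],
    which has 64 elements; this bounds [W] by 8 without linear algebra. *)
Definition point_cosets (W : {set V}) : {set V} :=
  \bigcup_(l : 'I_8) cosetV (v_ [set l]) W.

Lemma point_cosets_sub W : totally_singular W -> point_cosets W \subset LambdaM.
Proof.
case/tsP=> _ _ Ws; apply/bigcupsP=> l _; apply/fintype.subsetP=> x.
rewrite mem_coset inE => /Ws/singular_even.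
by rewrite even_v_add points_even; case: (x \in LambdaP).
Qed.

Lemma card_point_cosets W : totally_singular W ->
  #|point_cosets W| = (8 * #|W|)%N.
Proof.
case/tsP=> _ WD Ws.
rewrite -sum1_card partition_disjoint_bigcup => [|l m nlm].
  rewrite (eq_bigr (fun=> #|W|)) => [|l _]; last by rewrite sum1_card card_coset.
  by rewrite sum_nat_const card_ord.
apply/pred0P=> x; rewrite /= !mem_coset; apply/negP => /andP[lx mx].
have := Ws _ (WD _ _ lx mx); rewrite [v_ [set m] + x]addrC addrA addKV.
by rewrite /singular sing_points addV_eq0 (inj_eq point_inj) (negPf nlm).
Qed.

Lemma ts_card_le8 W : totally_singular W -> (#|W| <= 8)%N.
Proof.
move=> tsW; have := subset_leq_card (point_cosets_sub tsW).
by rewrite card_point_cosets // card_LambdaM (@leq_mul2l 8 _ 8).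
Qed.

(** When [W] reaches the bound, the eight cosets fill [LambdaM]: every coset of
    [W] in [LambdaM] contains a point, and by the disjointness only one. *)
Lemma coset8_point W x : totally_singular W -> #|W| = 8%N -> x \notin LambdaP ->
  exists l, v_ [set l] + x \in W.
Proof.
move=> tsW W8 ox; have: x \in LambdaM by rewrite inE.
have /eqP <- : point_cosets W == LambdaM.
  by rewrite eqEcard point_cosets_sub // card_point_cosets // W8 card_LambdaM.
by case/bigcupP=> l _; rewrite mem_coset; exists l.
Qed.

(** * The thirty maximal totally singular subspaces *)

Definition span3 (a b c : V) : {set V} := grow c (grow b (grow a [set 0])).

(** Ordered bases of totally singular subspaces of dimension 3; independence
    is implied, since 0 is not [sing]. The grouping of the conjuncts is
    the one in which [a], [b], [c] are counted in turn. *)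
Definition frame (a b c : V) : bool :=
  [&& sing a, sing b && sing (a + b) &
      sing c && [&& sing (a + c), sing (b + c) & sing (a + b + c)]].

Lemma mem_span1 a w : w \in grow a [set 0] -> w = 0 \/ w = a.
Proof. by rewrite mem_grow !inE addV_eq0 => /orP[] /eqP; auto. Qed.

Lemma mem_span2 a b w : w \in grow b (grow a [set 0]) ->
  [\/ w = 0, w = a, w = b | w = a + b].
Proof.
rewrite mem_grow => /orP[] /mem_span1[]; first by constructor 1.
- by constructor 2.
- by move/eqP; rewrite addV_eq0 => /eqP <-; constructor 3.
- by move=> <-; constructor 4; rewrite addrC addVK.
Qed.

Lemma sing_span1 (a b : V) :
  reflect {in grow a [set 0], forall w, sing (b + w)} (sing b && sing (a + b)).
Proof.
apply: (iffP andP) => [[sb sab] w /mem_span1[]->|bX].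
- by rewrite addr0.
- by rewrite addrC.
rewrite -{1}[b]addr0 [a + b]addrC !bX ?mem_grow ?inE ?eqxx //.
by rewrite addVV eqxx orbT.
Qed.

Lemma sing_span2 (a b c : V) :
  reflect {in grow b (grow a [set 0]), forall w, sing (c + w)}
          (sing c && [&& sing (a + c), sing (b + c) & sing (a + b + c)]).
Proof.
apply: (iffP and4P) => [[sc sac sbc sabc] w /mem_span2[]->|cX].
- by rewrite addr0.
- by rewrite addrC.
- by rewrite addrC.
- by rewrite addrC.
rewrite -{1}[c]addr0 ![_ + c]addrC !cX ?mem_grow ?inE ?eqxx //.
- by rewrite [a + b]addrC addVK addVV eqxx !orbT.
- by rewrite addVV eqxx !orbT.
- by rewrite addVV eqxx !orbT.
Qed.

Lemma sing_notin (X : {set V}) c : {in X, forall w, sing (c + w)} -> c \notin X.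
Proof. by move=> cX; apply/negP => /cX; rewrite addVV sing0. Qed.

Lemma ts_span1 a : sing a ->
  totally_singular (grow a [set 0]) /\ #|grow a [set 0]| = 2%N.
Proof.
move=> sa; have [|-> ->] := ts_grow (c := a) ts_set0; last by rewrite cards1.
by move=> w; rewrite inE => /eqP->; rewrite addr0.
Qed.

Lemma ts_span2 a b : sing a -> sing b && sing (a + b) ->
  totally_singular (grow b (grow a [set 0])) /\
  #|grow b (grow a [set 0])| = 4%N.
Proof.
move=> sa /sing_span1 bX; have [ts1 c1] := ts_span1 sa.
by have [-> ->] := ts_grow ts1 bX; rewrite c1.
Qed.

Lemma ts_span3 a b c : frame a b c ->
  totally_singular (span3 a b c) /\ #|span3 a b c| = 8%N.
Proof.
case/and3P=> sa sab /sing_span2 cX; have [ts2 c2] := ts_span2 sa sab.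
by have [-> ->] := ts_grow ts2 cX; rewrite c2.
Qed.

Lemma max_ts8 W : totally_singular W -> #|W| = 8%N ->
  W \in max_totally_singular.
Proof.
move=> tsW W8; rewrite inE; apply/maxsetP; split=> // X tsX sWX.
by apply/eqP; rewrite eq_sym eqEcard sWX W8 ts_card_le8.
Qed.

Lemma ts_sing W x : totally_singular W -> x \in W -> x != 0 -> sing x.
Proof. by case/tsP=> _ _ Ws /Ws; rewrite /singular => /orP[->|]. Qed.

Lemma grow_sub c (W X : {set V}) :
    totally_singular W -> X \subset W -> c \in W ->
  grow c X \subset W.
Proof.
case/tsP=> _ WD _ sXW cW; apply/fintype.subsetP=> x; rewrite mem_grow.
case/orP=> [|cxX]; first exact: (fintype.subsetP sXW).
by rewrite -(addVK c x) WD // (fintype.subsetP sXW).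
Qed.

Lemma ts_outside (W X : {set V}) c : totally_singular W -> totally_singular X ->
    X \subset W -> c \in W -> c \notin X ->
  {in X, forall w, sing (c + w)}.
Proof.
move=> tsW tsX sXW cW cX w wX; apply: (ts_sing tsW).
  by have [_ WD _] := tsP _ tsW; apply: WD cW (fintype.subsetP sXW w wX).
by rewrite addV_eq0; apply: contraNneq cX => ->.
Qed.

(** A vector [c] that enlarges [X] prevents [X] from being maximal. *)
Lemma max_ts_outside (W X : {set V}) c : maxset totally_singular W ->
    totally_singular X -> X \subset W -> {in X, forall w, sing (c + w)} ->
  exists2 x, x \in W & x \notin X.
Proof.
move=> /maxsetP[tsW maxW] tsX sXW cX; apply/fintype.subsetPn/negP => sWX.
have EX : X = W by apply/eqP; rewrite eqEsubset sXW.
have [tsg cg] := ts_grow tsX cX.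
have Eg : grow c X = X by rewrite {2}EX; apply: maxW; rewrite // -EX subsetUl.
have [X0 _ _] := tsP _ tsX.
move/eqP: cg; rewrite Eg mul2n -addnn -{1}[#|X|]addn0 eqn_add2l eq_sym.
by rewrite cards_eq0 => /eqP X_0; rewrite X_0 inE in X0.
Qed.

(** The counts [card_sing], [card_sing2] and [card_sing3] are positive, so a
    maximal subspace cannot stop at dimension 0, 1 or 2. *)
Lemma max_ts_span3 W : W \in max_totally_singular ->
  exists a b c, frame a b c /\ span3 a b c \subset W.
Proof.
rewrite inE => maxW; have tsW := maxsetp maxW; have [W0 _ _] := tsP _ tsW.
have s0W : [set 0] \subset W by rewrite sub1set.
have [a aW] : exists2 x, x \in W & x \notin [set 0].
  have /card_gt0P[x] : (0 < #|[set x | sing x]|)%N by rewrite card_sing.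
  rewrite inE => sx; apply: (max_ts_outside (c := x)) maxW ts_set0 s0W _ => w.
  by rewrite inE => /eqP->; rewrite addr0.
rewrite inE => /(ts_sing tsW aW) sa; have [ts1 _] := ts_span1 sa.
have s1W := grow_sub tsW s0W aW.
have [b bW] : exists2 x, x \in W & x \notin grow a [set 0].
  have := card_sing2 sa; set Z := [set _ | _] => cZ.
  have /card_gt0P[x] : (0 < #|Z|)%N by rewrite cZ.
  rewrite inE => /sing_span1; exact: max_ts_outside maxW ts1 s1W.
move/(ts_outside tsW ts1 s1W bW)/sing_span1 => sab.
have [ts2 _] := ts_span2 sa sab; have s2W := grow_sub tsW s1W bW.
have [c cW] : exists2 x, x \in W & x \notin grow b (grow a [set 0]).
  have [sb sab'] := andP sab.
  have := card_sing3 sa sb sab'; set Z := [set _ | _] => cZ.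
  have /card_gt0P[x] : (0 < #|Z|)%N by rewrite cZ.
  rewrite inE => /sing_span2; exact: max_ts_outside maxW ts2 s2W.
move/(ts_outside tsW ts2 s2W cW)/sing_span2 => sabc.
exists a, b, c; split; first exact/and3P.
exact: grow_sub tsW s2W cW.
Qed.

Lemma card_of_max_ts W : W \in max_totally_singular -> #|W| = 8%N.
Proof.
move=> maxW; have [a [b [c [fr sW]]]] := max_ts_span3 maxW.
move: maxW; rewrite inE => /maxsetp/ts_card_le8 W8.
apply/eqP; rewrite eqn_leq W8; have [_ <-] := ts_span3 fr.
exact: subset_leq_card.
Qed.

Lemma in_max_ts W :
  W \in max_totally_singular = totally_singular W && (#|W| == 8%N).
Proof.
apply/idP/andP => [maxW|[tsW /eqP]]; last exact: max_ts8.
rewrite card_of_max_ts //; split=> //.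
by move: maxW; rewrite inE => /maxsetp.
Qed.

Lemma card_dep_pairs (T1 T2 : finType) (P : pred T1) (R : T1 -> pred T2) n :
    (forall x, P x -> #|[set y | R x y]| = n) ->
  #|[set p | P p.1 && R p.1 p.2]| = (#|[set x | P x]| * n)%N.
Proof.
move=> Rn; rewrite -!sum1dep_card.
rewrite -(pair_big_dep P R (fun _ _ => 1%N)) big_distrl /=.
by apply: eq_bigr => x Px; rewrite mul1n sum1dep_card Rn.
Qed.

(** Frames are counted twice: one vector at a time in V, and inside each maximal
    totally singular subspace. *)
Definition frames : {set V * V * V} := [set f | frame f.1.1 f.1.2 f.2].

Lemma card_frames : #|frames| = (35 * 18 * 8)%N.
Proof.
pose P2 (p : V * V) := sing p.1 && (sing p.2 && sing (p.1 + p.2)).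
pose P3 (p : V * V) c := sing c &&
  [&& sing (p.1 + c), sing (p.2 + c) & sing (p.1 + p.2 + c)].
have -> : frames = [set f | P2 f.1 && P3 f.1 f.2].
  by apply/setP=> f; rewrite !inE /frame /P2 /P3 !andbA.
rewrite (card_dep_pairs (P := P2) (R := P3) (n := 8)); last first.
  by case=> a b /and3P[sa sb sab]; apply: card_sing3.
pose orth a b := sing b && sing (a + b).
rewrite -card_sing -(card_dep_pairs (R := orth)) //.
exact: card_sing2.
Qed.

Lemma card_frames_of W : W \in max_totally_singular ->
  #|[set f in frames | span3 f.1.1 f.1.2 f.2 == W]| = (7 * 6 * 4)%N.
Proof.
rewrite in_max_ts => /andP[tsW /eqP W8].
have [W0 WD _] := tsP _ tsW.
have s0W : [set 0] \subset W by rewrite sub1set.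
pose P1 (a : V) := (a \in W) && (a \notin [set 0]).
pose P2 (p : V * V) :=
  P1 p.1 && ((p.2 \in W) && (p.2 \notin grow p.1 [set 0])).
pose P3 (p : V * V) (c : V) :=
  (c \in W) && (c \notin grow p.2 (grow p.1 [set 0])).
have sing1 a : P1 a -> sing a.
  by case/andP=> aW; rewrite inE => /(ts_sing tsW aW).
have sing2 a b : P1 a -> b \in W -> b \notin grow a [set 0] ->
    sing b && sing (a + b).
  move=> P1a bW nb; apply/sing_span1.
  have [ts1 _] := ts_span1 (sing1 a P1a).
  apply: (ts_outside tsW ts1 _ bW nb).
  by apply: (grow_sub tsW s0W); case/andP: P1a.
have card_out (X : {set V}) : X \subset W ->
    #|[set x | (x \in W) && (x \notin X)]| = (8 - #|X|)%N.
  move=> sXW; have := cardsD W X; rewrite (setIidPr sXW) W8 => <-.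
  by apply: eq_card => x; rewrite !inE andbC.
have -> : [set f in frames | span3 f.1.1 f.1.2 f.2 == W]
    = [set f | P2 f.1 && P3 f.1 f.2].
  apply/setP=> -[[a b] c]; rewrite !inE /=.
  apply/andP/andP=> -[].
    case/and3P=> sa /sing_span1 bX /sing_span2 cX /eqP EW.
    rewrite /P2 /P3 /P1 /= -EW (sing_notin bX) (sing_notin cX).
    have a0 : a != 0 by apply: contraTneq sa => ->; rewrite sing0.
    rewrite in_set1 a0 /=.
    by rewrite /span3; split; rewrite !mem_grow !addVV !in_set1 !eqxx !orbT.
  case/andP=> P1a /andP[/= bW nb] /andP[/= cW nc].
  have [aW _] := andP P1a; have sa := sing1 a P1a.
  have sab := sing2 a b P1a bW nb.
  have [ts2 _] := ts_span2 sa sab; have s1W := grow_sub tsW s0W aW.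
  have s2W := grow_sub tsW s1W bW.
  have fr : frame a b c.
    by apply/and3P; split=> //; apply/sing_span2/(ts_outside tsW ts2 s2W cW nc).
  split=> //; have [_ c3] := ts_span3 fr.
  by rewrite eqEcard W8 c3 leqnn andbT; apply: grow_sub tsW s2W cW.
rewrite (card_dep_pairs (P := P2) (R := P3) (n := 4)); last first.
  case=> a b /andP[P1a /andP[bW nb]]; rewrite card_out.
    by have [_ ->] := ts_span2 (sing1 a P1a) (sing2 a b P1a bW nb).
  apply: (grow_sub tsW) => //; apply: (grow_sub tsW) => //.
  by case/andP: P1a.
have <- : #|[set x | P1 x]| = 7%N by rewrite card_out // cards1.
congr (_ * _)%N.
pose out1 (a b : V) := (b \in W) && (b \notin grow a [set 0]).
rewrite -(card_dep_pairs (R := out1)) //.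
move=> a P1a; rewrite card_out; first by have [_ ->] := ts_span1 (sing1 a P1a).
by apply: (grow_sub tsW) => //; case/andP: P1a.
Qed.

(** The double count 35 * 18 * 8 = 30 * (7 * 6 * 4). *)
Lemma card_max_ts : #|max_totally_singular| = 30%N.
Proof.
have : #|frames| = (#|max_totally_singular| * 168)%N.
  rewrite -sum1_card (partition_big (fun f => span3 f.1.1 f.1.2 f.2)
    (mem max_totally_singular)) /= => [|[[a b] c]]; last first.
    rewrite inE => /ts_span3[ts3 c3]; exact: max_ts8.
  rewrite -sum_nat_const; apply: eq_bigr => W maxW.
  by rewrite -[RHS]/(7 * 6 * 4)%N -(card_frames_of maxW) -sum1dep_card.
by rewrite card_frames => /eqP; rewrite -[(35 * 18 * 8)%N]/(30 * 168)%N
  eqn_pmul2r // => /eqP.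
Qed.

(** * Maximally separated sets *)

Lemma pairwise_separatedP (S : {set V}) :
  reflect {in S &, forall x y, x != y -> sing (x + y)} (pairwise_separated S).
Proof.
apply: (iffP forall_inP) => [sepS x y xS yS nxy|sepS x xS].
  by rewrite -separatedE; have /forall_inP/(_ y yS)/implyP := sepS x xS; apply.
apply/forall_inP=> y yS; apply/implyP=> nxy.
by rewrite separatedE sepS.
Qed.

Lemma singular_separated (S : {set V}) x y : pairwise_separated S ->
  x \in S -> y \in S -> singular (x + y).
Proof.
move/pairwise_separatedP=> sepS xS yS; rewrite /singular addV_eq0.
by case: eqVneq => //= nxy; apply: sepS.
Qed.

Lemma coset_separated W x :
  totally_singular W -> pairwise_separated (cosetV x W).
Proof.
move=> tsW; apply/pairwise_separatedP => y z; rewrite !mem_coset => yW zW nyz.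
apply: (ts_sing tsW); last by rewrite addV_eq0.
have [_ WD _] := tsP _ tsW.
by have := WD _ _ yW zW; rewrite [x + y]addrC -addrA addVK.
Qed.

Lemma cosetK x W : cosetV x (cosetV x W) = W.
Proof. by apply/setP=> y; rewrite !mem_coset addVK. Qed.

Lemma coset_eq W x y : totally_singular W -> y \in cosetV x W ->
  cosetV x W = cosetV y W.
Proof.
case/tsP=> _ WD _; rewrite mem_coset => xyW; apply/setP=> z; rewrite !mem_coset.
apply/idP/idP => zW; have := WD _ _ xyW zW.
  by rewrite [x + y]addrC -addrA addVK.
by rewrite addrA addKV.
Qed.

(** Translate a separated set so that it contains 0. A totally singular subspace
    [W] that is maximal among those with singular sums with the set must contain
    it: a member outside [W] could be adjoined to [W], by [singular_add3]. *)
Lemma separated_sub_coset S s : pairwise_separated S -> s \in S ->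
  exists2 W, W \in max_totally_singular & S \subset cosetV s W.
Proof.
move=> sepS sS.
pose compat W := totally_singular W &&
  [forall w in W, forall x in S, singular (w + (x + s))].
(* The zero subspace is compatible because the set itself is separated. *)
have [|W /maxsetP[/andP[tsW /forall_inP cW] maxW] _] :=
    @maxset_exists _ compat [set 0].
  rewrite /compat ts_set0; apply/forall_inP=> w; rewrite inE => /eqP->.
  by apply/forall_inP=> x xS; rewrite add0r (singular_separated sepS).
have{}cW w x : w \in W -> x \in S -> singular (w + (x + s)).
  by move=> wW xS; have /forall_inP/(_ x xS) := cW w wW.
have [W0 _ Ws] := tsP _ tsW.
have sSW : S \subset cosetV s W.
  apply/fintype.subsetP=> x xS; rewrite mem_coset; apply/negPn/negP => nxW.
  have gx : {in W, forall w, sing (s + x + w)}.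
    move=> w wW; have := cW w x wW xS; rewrite addrC [x + s]addrC.
    case/orP=> //; rewrite addV_eq0 => /eqP Ew.
    by rewrite Ew wW in nxW.
  have [tsg _] := ts_grow tsW gx.
  have cg : compat (grow (s + x) W).
    rewrite /compat tsg; apply/forall_inP=> w; rewrite mem_grow => wg.
    apply/forall_inP=> y yS; case/orP: wg => [wW|]; first exact: cW.
    set w' := _ + w => wW; have -> : w = w' + (x + s).
      by rewrite /w' [x + s]addrC [_ + w]addrC addKV.
    have sxy : singular (x + s + (y + s)).
      by rewrite addrACA addVV addr0 (singular_separated sepS).
    apply: singular_add3 (Ws _ wW) _ _ (cW _ _ wW xS) (cW _ _ wW yS) sxy;
      exact: singular_separated sepS _ _.
  have /setP/(_ (s + x)) := maxW _ cg (subsetUl _ _).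
  by rewrite mem_grow addVV W0 orbT (negPf nxW).
have [W' maxW' sWW'] := maxset_exists tsW.
exists W'; first by rewrite inE.
apply: fintype.subset_trans sSW _; apply/fintype.subsetP=> x.
by rewrite !mem_coset; apply: (fintype.subsetP sWW').
Qed.

Lemma separated_card_le8 S : pairwise_separated S -> (#|S| <= 8)%N.
Proof.
move=> sepS; have [->|[s sS]] := set_0Vmem S; first by rewrite cards0.
have [W maxW /subset_leq_card] := separated_sub_coset sepS sS.
by rewrite card_coset (card_of_max_ts maxW).
Qed.

(** The bound 8 is attained, by a totally singular subspace. *)
Lemma mem_Omega_A S : S \in Omega_A = pairwise_separated S && (#|S| == 8%N).
Proof.
rewrite inE /maximally_separated; apply: andb_id2l => sepS.
apply/forall_inP/eqP => [maxS|S8 T /separated_card_le8]; last by rewrite S8.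
apply/eqP; rewrite eqn_leq separated_card_le8 //=.
have /card_gt0P[W maxW] : (0 < #|max_totally_singular|)%N by rewrite card_max_ts.
rewrite -(card_of_max_ts maxW) -(card_coset 0) maxS //.
by apply: coset_separated; move: maxW; rewrite in_max_ts => /andP[].
Qed.

Lemma Omega_A_coset S s : S \in Omega_A -> s \in S ->
  exists2 W, W \in max_totally_singular & S = cosetV s W.
Proof.
rewrite mem_Omega_A => /andP[sepS /eqP S8] sS.
have [W maxW sSW] := separated_sub_coset sepS sS; exists W => //.
by apply/eqP; rewrite eqEcard sSW S8 card_coset (card_of_max_ts maxW).
Qed.

Lemma coset_Omega_A x W : W \in max_totally_singular -> cosetV x W \in Omega_A.
Proof.
rewrite mem_Omega_A in_max_ts card_coset => /andP[tsW ->].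
by rewrite coset_separated.
Qed.

Lemma Omega_A_cosets :
  Omega_A = [set cosetV x W | x in [set: V], W in max_totally_singular].
Proof.
apply/setP=> S; apply/idP/imset2P => [SA|[x W _ maxW ->]].
  have [s sS] : exists s, s \in S.
    apply/card_gt0P; move: SA; rewrite mem_Omega_A => /andP[_ /eqP->] //.
  have [W maxW ES] := Omega_A_coset SA sS.
  exact: Imset2spec (finset.in_setT s) maxW ES.
exact: coset_Omega_A.
Qed.

(** [Omega_AP] and [Omega_AM] are the cases [LambdaP] and [LambdaM]. *)
Definition Omega_in (D : {set V}) : {set {set V}} :=
  [set S in Omega_A | S \subset D].

Lemma mem_Omega_in (D S : {set V}) :
  (S \in Omega_in D) = (S \in Omega_A) && (S \subset D).
Proof. by rewrite finset.in_set. Qed.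

(** Each of the 30 subspaces is translated by the 64 elements of [D]; each coset
    arises from its own 8 elements and a single subspace. *)
Lemma card_Omega_in (D : {set V}) : #|D| = 64%N ->
    (forall x y, x \in D -> x + y \in LambdaP -> y \in D) ->
  #|Omega_in D| = 240%N.
Proof.
move=> D64 Dco.
have cosD x W : x \in D -> W \in max_totally_singular ->
    cosetV x W \in Omega_in D.
  move=> xD maxW; rewrite inE coset_Omega_A //=; apply/fintype.subsetP=> y.
  rewrite mem_coset; move: maxW; rewrite in_max_ts.
  case/andP=> /tsP[_ _ Ws] _ xyW.
  exact/(Dco x)/singular_even/Ws.
have : #|setX D max_totally_singular| = (#|Omega_in D| * 8)%N.
  rewrite -sum1_card (partition_big (fun p => cosetV p.1 p.2)
    (mem (Omega_in D))) /= => [|[x W]]; last first.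
    by rewrite inE /= => /andP[xD maxW]; apply: cosD.
  rewrite -sum_nat_const; apply: eq_bigr => S SD; rewrite sum1dep_card.
  have [SA sSD] : S \in Omega_A /\ S \subset D.
    by apply/andP; move: SD; rewrite inE.
  have S8 : #|S| = 8%N by move: SA; rewrite mem_Omega_A => /andP[_ /eqP].
  have [s sS] : exists s, s \in S by apply/card_gt0P; rewrite S8.
  have [W maxW ES] := Omega_A_coset SA sS.
  have tsW : totally_singular W by move: maxW; rewrite in_max_ts => /andP[].
  have [W0 WD _] := tsP _ tsW.
  (* The pairs that produce S are those with x in S, and then W is x + S. *)
  rewrite -S8 -[#|S|]muln1 -(cards1 W) -cardsX.
  apply: eq_card => -[x W'].
  rewrite finset.in_set /= !finset.in_setX finset.in_set1 /=; apply/andP/andP.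
    case=> /andP[xD maxW'] /eqP ES'.
    have [W'0 _ _] : [/\ 0 \in W', {in W' &, forall x y, x + y \in W'}
        & {in W', forall x, singular x}].
      by apply/tsP; move: maxW'; rewrite in_max_ts => /andP[].
    have xS : x \in S by rewrite -ES' mem_coset addVV.
    by rewrite -(cosetK x W') ES' {2}ES (coset_eq tsW (y := x)) -?ES ?cosetK.
  case=> xS /eqP->; rewrite maxW (fintype.subsetP sSD) //; split=> //.
  by rewrite ES (coset_eq tsW (y := x)) -?ES.
rewrite cardsX D64 card_max_ts -[(64 * 30)%N]/(240 * 8)%N => /eqP.
by rewrite eqn_pmul2r // => /eqP.
Qed.

Lemma card_Omega_AP : #|Omega_AP| = 240%N.
Proof.
apply: card_Omega_in card_LambdaP _ => x y xP.
by rewrite even_v_add xP => /eqP.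
Qed.

Lemma card_Omega_AM : #|Omega_AM| = 240%N.
Proof.
apply: card_Omega_in card_LambdaM _ => x y; rewrite !inE => /negPf xM.
by rewrite even_v_add xM; case: (y \in LambdaP).
Qed.

Lemma Omega_A_split : Omega_A = Omega_AP :|: Omega_AM.
Proof.
apply/setP=> S; rewrite finset.in_setU.
rewrite [S \in Omega_AP](mem_Omega_in LambdaP).
rewrite [S \in Omega_AM](mem_Omega_in LambdaM) -andb_orr.
have [SA|//] := boolP (S \in Omega_A); apply/esym.
have [s sS] : exists s, s \in S.
  by apply/card_gt0P; move: SA; rewrite mem_Omega_A => /andP[_ /eqP->].
have [W maxW ->] := Omega_A_coset SA sS; move: maxW; rewrite in_max_ts.
case/andP=> /tsP[_ _ Ws] _; apply/orP.
case: (boolP (s \in LambdaP)) => sP; [left|right]; apply/fintype.subsetP=> x;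
  rewrite mem_coset ?finset.in_setC => /Ws/singular_even; rewrite even_v_add.
  by rewrite sP => /eqP.
by rewrite (negPf sP); case: (x \in LambdaP).
Qed.

Lemma Omega_A_disjoint : [disjoint Omega_AP & Omega_AM].
Proof.
apply/pred0P=> S; apply/negP; rewrite /= (mem_Omega_in LambdaP).
rewrite (mem_Omega_in LambdaM).
case/andP=> /andP[SA /fintype.subsetP SP] /andP[_ /fintype.subsetP SM].
have [s sS] : exists s, s \in S.
  by apply/card_gt0P; move: SA; rewrite mem_Omega_A => /andP[_ /eqP->].
by have := SM s sS; rewrite inE SP.
Qed.

(** * Labelled Fano planes *)

Lemma triple_inj (s t : {set 'I_8}) : #|s| = 3%N -> #|t| = 3%N ->
  v_ s = v_ t -> s = t.
Proof.
move=> s3 t3 /eqP; rewrite eq_v => /orP[/eqP//|/eqP Est].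
by have := s3; rewrite Est card_setC8 t3.
Qed.

Lemma triple_not_point (t : {set 'I_8}) : #|t| = 3%N -> v_ t \notin points.
Proof. by rewrite points_v => ->. Qed.

Lemma mem_points l : v_ [set l] \in points.
Proof. exact: imset_f. Qed.

Lemma sing_triples (s t : {set 'I_8}) : #|s| = 3%N -> #|t| = 3%N ->
  sing (v_ s + v_ t) = (#|s :&: t| == 1%N).
Proof.
move=> s3 t3; rewrite v_D sing_v card_symd s3 t3.
by have := subset_leq_card (subsetIl s t); rewrite s3; case: #|_| => [|[|[|[|]]]].
Qed.

Lemma sing_point_triple l (t : {set 'I_8}) : #|t| = 3%N ->
  sing (v_ [set l] + v_ t) = (l \notin t).
Proof.
move=> t3; rewrite v_D sing_v card_symd t3 cards1.
have [lt|nlt] := boolP (l \in t).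
  by rewrite (setIidPl _) ?cards1 // sub1set.
rewrite (_ : _ :&: _ = set0) ?cards0 //; apply/setP=> i; rewrite !inE.
by case: eqP => //= ->; apply: negbTE.
Qed.

Definition triple_system (x : {set {set 'I_8}}) : Prop :=
  forall t, t \in x -> #|t| = 3%N.

Definition meeting_once (x : {set {set 'I_8}}) : Prop :=
  triple_system x /\
  {in x &, forall s t, s != t -> #|s :&: t| = 1%N}.

(** The set [lambdaM_fano x] for a system of triples [x] with basepoint [l]. *)
Definition pointed (l : 'I_8) (x : {set {set 'I_8}}) : {set V} :=
  v_ [set l] |: [set v_ t | t in x].

Lemma card_pointed l x : triple_system x -> #|pointed l x| = #|x|.+1.
Proof.
move=> x3; rewrite cardsU1 card_in_imset => [|s t /x3 s3 /x3 t3]; last first.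
  exact: triple_inj.
suff -> : v_ [set l] \notin [set v_ t | t in x] by [].
apply/imsetP=> -[t /x3 t3 E]; have := triple_not_point t3.
by rewrite -E mem_points.
Qed.

Lemma meeting_once_separated x : meeting_once x ->
  pairwise_separated [set v_ t | t in x].
Proof.
case=> x3 x1; apply/pairwise_separatedP => _ _ /imsetP[s sx ->] /imsetP[t tx ->].
move=> nst; rewrite (sing_triples (x3 s sx) (x3 t tx)) x1 //.
by apply: contraNneq nst => ->.
Qed.

(** Seven triples meeting pairwise in one label are separated in [LambdaM], so
    they lie in an 8-element coset; its remaining element is the only point that
    it contains. *)
Lemma pointed_Omega_A x : meeting_once x -> #|x| = 7%N ->
  exists l, pointed l x \in Omega_A.
Proof.
move=> mx x7; have [x3 _] := mx.
have [t0 t0x] : exists t, t \in x by apply/card_gt0P; rewrite x7.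
have [W maxW sxW] :=
  separated_sub_coset (meeting_once_separated mx) (imset_f v_ t0x).
have [tsW W8] : totally_singular W /\ #|W| = 8%N.
  by move: maxW; rewrite in_max_ts => /andP[? /eqP].
have [l lW] : exists l, v_ [set l] + v_ t0 \in W.
  by apply: coset8_point; rewrite // v_even (x3 t0 t0x).
exists l; suff -> : pointed l x = cosetV (v_ t0) W by apply: coset_Omega_A.
apply/eqP; rewrite eqEcard card_coset W8 card_pointed // x7 leqnn andbT.
by rewrite finset.subUset sxW finset.sub1set mem_coset addrC lW.
Qed.

Lemma pointed_point l m x : triple_system x ->
  v_ [set m] \in pointed l x -> m = l.
Proof.
move=> x3; rewrite in_setU1 => /orP[/eqP/point_inj//|/imsetP[t /x3 t3 E]].
by have := triple_not_point t3; rewrite -E mem_points.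
Qed.

Lemma pointed_cover l x : triple_system x ->
  pointed l x \in Omega_A -> forall t, t \in x -> l \notin t.
Proof.
move=> x3; rewrite mem_Omega_A => /andP[/pairwise_separatedP sepS _] t tx.
rewrite -(sing_point_triple _ (x3 t tx)).
apply: sepS (setU11 _ _) (setU1r _ (imset_f _ tx)) _.
by apply: contraNneq (triple_not_point (x3 t tx)) => <-; apply: mem_points.
Qed.

(** Existence of the line through two labels needs no incidence count: if
    v_[m] is the point in the coset of v_[l; i; j] modulo [W], then v_[m; i; j]
    lies in the coset of v_[l], which is [pointed l x]. *)
Lemma pointed_line l x i j : triple_system x ->
    pointed l x \in Omega_A -> i != l -> j != l -> i != j ->
  exists2 t, t \in x & (i \in t) && (j \in t).
Proof.
move=> x3 xA il jl ij; pose y := v_ [set l] + (v_ [set i] + v_ [set j]).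
have lS : v_ [set l] \in pointed l x by rewrite in_setU1 eqxx.
have [W maxW ES] := Omega_A_coset xA lS.
have [tsW W8] : totally_singular W /\ #|W| = 8%N.
  by move: maxW; rewrite in_max_ts => /andP[? /eqP].
have [|m mW] := coset8_point (x := y) tsW W8.
  by rewrite !even_v_add !points_even.
have : v_ [set m] + (v_ [set i] + v_ [set j]) \in pointed l x.
  by rewrite ES mem_coset addrCA.
have [->|mi] := eqVneq m i.
  by rewrite addVK => /(pointed_point x3) E; rewrite E eqxx in jl.
have [->|mj] := eqVneq m j.
  rewrite [v_ [set i] + _]addrC addVK => /(pointed_point x3) E.
  by rewrite E eqxx in il.
have -> : v_ [set m] + (v_ [set i] + v_ [set j]) = v_ [set m; i; j].
  rewrite !v_D; congr v_; apply/setP=> k; rewrite !inE.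
  have [->|km] := eqVneq k m; first by rewrite (negPf mi) (negPf mj).
  by have [->|//] := eqVneq k i; rewrite (negPf ij).
have c3 : #|[set m; i; j]| = 3%N.
  rewrite -setUA cardsU1 cards2 ij !inE negb_or mi mj //.
rewrite in_setU1 => /orP[/eqP E|/imsetP[t tx]].
  by have := triple_not_point c3; rewrite E mem_points.
move=> /(triple_inj c3 (x3 t tx)) Et; exists t => //.
by rewrite -Et !inE !eqxx !orbT.
Qed.

Lemma cover_pointed l x : triple_system x ->
  pointed l x \in Omega_A -> cover x = ~: [set l].
Proof.
move=> x3 xA; apply/setP=> i; rewrite !inE; apply/bigcupP/idP => [[t tx it]|il].
  by apply: contraTneq it => ->; apply: pointed_cover xA t tx.
(* Any second label gives a triple through i. *)
have [j] : exists j, j \in ~: [set i; l].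
  by apply/card_gt0P; rewrite card_setC8 cards2 subn_gt0; case: (i != l).
rewrite !inE negb_or => /andP[ji jl].
have [|t tx /andP[it _]] := pointed_line x3 xA il jl; first by rewrite eq_sym.
by exists t.
Qed.

Lemma fano_meeting_once x : x \in fano_planes -> meeting_once x /\ #|x| = 7%N.
Proof.
rewrite inE => /and5P[/eqP x7 /forall_inP x3 _ _ /forall_inP x1]; split=> //.
split=> [t /x3/eqP//|s t sx tx nst].
by have /forall_inP/(_ t tx)/implyP/(_ nst)/eqP := x1 s sx.
Qed.

(** By [pointed_line] any two labels other than the basepoint are on a line, and
    lines with two common labels coincide. *)
Lemma meeting_once_fano x : meeting_once x -> #|x| = 7%N -> x \in fano_planes.
Proof.
move=> mx x7; have [l xA] := pointed_Omega_A mx x7; have [x3 x1] := mx.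
have Ex := cover_pointed x3 xA.
rewrite inE x7 eqxx Ex card_setC8 cards1; apply/and5P; split=> //.
- by apply/forall_inP=> t /x3->.
- apply/forall_inP=> i; rewrite !inE => il.
  apply/forall_inP=> j; rewrite !inE => jl.
  apply/implyP=> ij; have [t tx ijt] := pointed_line x3 xA il jl ij.
  apply/cards1P; exists t; apply/setP=> s; rewrite !inE.
  apply/andP/eqP => [[sx /andP[ijs jjs]]|->//].
  apply/eqP/negPn/negP=> nst; have := x1 s t sx tx nst; apply/eqP.
  have /subset_leq_card : [set i; j] \subset s :&: t.
    have /andP[it jt] := ijt.
    by apply/fintype.subsetP=> k; rewrite !inE => /orP[] /eqP->; rewrite ?ijs ?jjs.
  by rewrite cards2 ij; case: #|_| => [|[|]].
- apply/forall_inP=> s sx; apply/forall_inP=> t tx; apply/implyP=> nst.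
  by rewrite x1.
Qed.

Lemma lambdaM_fano_pointed l x : cover x = ~: [set l] ->
  lambdaM_fano x = pointed l x.
Proof.
move=> Ex; rewrite /lambdaM_fano /pointed Ex.
by rewrite finset.setCK imset_set1 finset.setUC.
Qed.

Lemma pointed_odd l x : triple_system x -> pointed l x \subset LambdaM.
Proof.
move=> x3; apply/fintype.subsetP=> y; rewrite in_setU1 finset.in_setC.
by case/orP=> [/eqP->|/imsetP[t /x3 t3 ->]]; rewrite ?points_even // v_even t3.
Qed.

Lemma fano_pointed x : x \in fano_planes ->
  exists l, [/\ lambdaM_fano x = pointed l x, pointed l x \in Omega_AM
     & triple_system x].
Proof.
case/fano_meeting_once=> mx x7; have [l xA] := pointed_Omega_A mx x7.
have [x3 _] := mx; exists l; split=> //.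
  exact/lambdaM_fano_pointed/cover_pointed.
by rewrite inE xA pointed_odd.
Qed.

Lemma lambdaM_fano_Omega_AM x : x \in fano_planes -> lambdaM_fano x \in Omega_AM.
Proof. by case/fano_pointed=> l [->]. Qed.

Lemma mem_pointed_triple l x (t : {set 'I_8}) : triple_system x ->
  #|t| = 3%N -> (v_ t \in pointed l x) = (t \in x).
Proof.
move=> x3 t3; rewrite in_setU1; apply/orP/idP => [[/eqP E|/imsetP[s sx]]|tx].
- by have := triple_not_point t3; rewrite E mem_points.
- by move/(triple_inj t3 (x3 s sx)) => ->.
- by right; apply: imset_f.
Qed.

Lemma lambdaM_fano_inj : {in fano_planes &, injective lambdaM_fano}.
Proof.
move=> x y /fano_pointed[l [-> _ x3]] /fano_pointed[m [-> _ y3]] Exy.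
apply/setP=> t; have [t3|t3] := eqVneq #|t| 3%N.
  by rewrite -(mem_pointed_triple l x3) // Exy mem_pointed_triple.
by apply/idP/idP => [/x3|/y3] E; rewrite E in t3.
Qed.

Lemma odd_v (x : V) : x \notin LambdaP ->
  (x \in points) \/ exists2 t : {set 'I_8}, #|t| = 3%N & x = v_ t.
Proof.
have [A ->] := v_surj x; rewrite v_even points_v negbK !inE.
have := card_le8 A; move EA: #|A| => n; do 9?[case: n EA => [|n] EA] => // _ _.
- by left.
- by right; exists A.
- by right; exists (~: A); rewrite ?v_setC // card_setC8 EA.
- by left.
Qed.

(** An element of [Omega_AM] is a coset with exactly one point; its other seven
    members are triples that meet pairwise in one label. *)
Lemma lambdaM_fano_surj S : S \in Omega_AM ->
  exists2 x, x \in fano_planes & lambdaM_fano x = S.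
Proof.
rewrite inE => /andP[SA SM].
pose x := [set t : {set 'I_8} | (#|t| == 3) && (v_ t \in S)].
have x3 : triple_system x by move=> t; rewrite inE => /andP[/eqP].
have [/pairwise_separatedP sepS S8] : pairwise_separated S /\ #|S| = 8%N.
  by move: SA; rewrite mem_Omega_A => /andP[? /eqP].
have [s sS] : exists s, s \in S by apply/card_gt0P; rewrite S8.
have [W maxW ES] := Omega_A_coset SA sS.
have [tsW W8] : totally_singular W /\ #|W| = 8%N.
  by move: maxW; rewrite in_max_ts => /andP[? /eqP].
have [l] : exists l, v_ [set l] + s \in W.
  by apply: coset8_point => //; have := fintype.subsetP SM s sS; rewrite inE.
rewrite addrC -mem_coset -ES => lS.
have ESx : S = pointed l x.
  apply/setP=> y; rewrite in_setU1; apply/idP/orP => [yS|[/eqP->//|/imsetP[t]]].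
    have [|/imsetP[m _ E]|[t t3 E]] := odd_v (x := y).
    - by have := fintype.subsetP SM y yS; rewrite inE.
    - left; rewrite E (inj_eq point_inj); apply/negPn/negP => nml.
      have := sepS _ _ yS lS; rewrite E (inj_eq point_inj) sing_points.
      by move/(_ nml).
    - by right; apply/imsetP; exists t => //; rewrite inE t3 eqxx -E.
  by rewrite inE => /andP[_ tS] ->.
have x7 : #|x| = 7%N by apply/eqP; rewrite -eqSS -(card_pointed l) -?ESx ?S8.
have mx : meeting_once x.
  split=> // t u tx ux ntu; apply/eqP; rewrite -(sing_triples (x3 t tx) (x3 u ux)).
  apply: sepS; try by move: tx ux; rewrite !inE => /andP[_ ?] /andP[_ ?].
  by apply: contraNneq ntu => /(triple_inj (x3 t tx) (x3 u ux)) ->.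
exists x; first exact: meeting_once_fano.
by rewrite ESx; apply/lambdaM_fano_pointed/cover_pointed; rewrite // -ESx.
Qed.

(** * Lines as singular vectors *)

Lemma card_pg_points : #|pg_points| = 15%N.
Proof.
have := card_mx 'F_2 1 4; rewrite card_Fp // -cardsT (cardsD1 0) inE /= => E.
apply: succn_inj; rewrite -[16%N]/((2 ^ (1 * 4))%N) -E add1n; congr _.+1.
by apply: eq_card => p; rewrite !inE andbT.
Qed.

Lemma line_throughE (p q : 'rV['F_2]_4) : p != 0 -> q != 0 -> p != q ->
  line_through p q = [set p; q; p + q].
Proof.
move=> p0 q0 pq; apply/setP=> r; rewrite !inE span_cons span_seq1.
have char2 (u : 'rV['F_2]_4) : u + u = 0.
  apply/rowP=> i; rewrite !mxE; by case: (F2P (u 0 i)) => ->; apply/val_inj.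
apply/andP/idP => [[r0 /memv_addP[_ /vlineP[a ->] [_ /vlineP[b ->] Er]]]|].
  move: r0; rewrite Er; case: (F2P a) => ->; case: (F2P b) => ->;
    rewrite ?scale0r ?scale1r ?addr0 ?add0r ?eqxx ?orbT //.
case/orP=> [/orP[]|] /eqP->; split=> //.
- by rewrite (subvP (addvSl _ _)) ?memv_line.
- by rewrite (subvP (addvSr _ _)) ?memv_line.
- by apply: contraNneq pq => pq0; rewrite -[p]addr0 -(char2 q) addrA pq0 add0r.
- by apply/memv_addP; exists p; rewrite ?memv_line //; exists q; rewrite ?memv_line.
Qed.

Lemma card_pg_line L : L \in pg_lines -> #|L| = 3%N.
Proof.
case/imset2P=> p q; rewrite !inE => p0 /andP[q0 pq] ->.
rewrite line_throughE // -setUA cardsU1 cards2 !inE negb_or pq /=.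
rewrite -{1}[p]addr0 (inj_eq (addrI p)) eq_sym q0 /=.
by rewrite -{1}[q]add0r (inj_eq (addIr q)) eq_sym p0.
Qed.

Lemma pg_line_sub L : L \in pg_lines -> L \subset pg_points.
Proof.
case/imset2P=> p q _ _ ->; apply/fintype.subsetP=> r; rewrite finset.in_set.
by case/andP.
Qed.

(** The Klein correspondence: a line becomes the singular vector
    of the 4-subset made of [phi L] and the last label, and two lines meet
    exactly when their vectors are orthogonal. *)
Definition psi (phi : {set 'rV['F_2]_4} -> {set 'I_8})
    (L : {set 'rV['F_2]_4}) : V :=
  v_ [set label 8] + v_ (phi L).

Lemma phi_triple phi L : line_identification phi -> L \in pg_lines ->
  #|phi L| = 3%N /\ label 8 \notin phi L.
Proof.
case=> -[sub _ _] _ /sub /=; rewrite inE; by case/andP=> /eqP.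
Qed.

Lemma psi_sing phi L : line_identification phi -> L \in pg_lines ->
  sing (psi phi L).
Proof. by move=> hphi /(phi_triple hphi)[t3 t8]; rewrite sing_point_triple. Qed.

Lemma psi_inj phi :
  line_identification phi -> {in pg_lines &, injective (psi phi)}.
Proof.
move=> hphi L M hL hM /addrI E.
have [[_ inj _] _] := hphi; apply: inj; [exact: mem_set|exact: mem_set|].
exact: triple_inj (phi_triple hphi hL).1 (phi_triple hphi hM).1 E.
Qed.

Lemma psi_surj phi x : line_identification phi -> sing x ->
  exists2 L, L \in pg_lines & psi phi L = x.
Proof.
move=> [[_ _ surj] _] sx.
have [||[t t3 Et]] := odd_v (x := v_ [set label 8] + x).
- by rewrite even_v_add points_even sing_even.
- case/imsetP=> m _ E; move: sx.
  by rewrite -(addVK (v_ [set label 8]) x) E sing_points.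
have [|L hL EL] := surj t.
  by rewrite /= inE t3 eqxx -(sing_point_triple _ t3) -Et addVK.
by exists L => //; rewrite /psi EL -Et addVK.
Qed.

Lemma psi_meet phi L M : line_identification phi ->
    L \in pg_lines -> M \in pg_lines -> L != M ->
  (L :&: M != set0) = sing (psi phi L + psi phi M).
Proof.
move=> hphi hL hM nLM; rewrite /psi addrACA addVV add0r.
rewrite (sing_triples (phi_triple hphi hL).1 (phi_triple hphi hM).1).
by case: hphi => _; apply.
Qed.

Lemma iota8_v T : v_ [set label 8] + v_ (iota8 T) = v_ T.
Proof.
have iota_D (B : {set 'I_8}) : label 8 \in B ->
    v_ [set label 8] + v_ (B :\ label 8) = v_ B.
  move=> B8; rewrite v_D; congr v_; apply/setP=> i; rewrite !inE.
  by case: eqP => [->|]; rewrite ?B8.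
rewrite /iota8; case: ifP => T8; first exact: iota_D.
by rewrite iota_D ?v_setC // inE T8.
Qed.

Lemma card_iota8 (T : {set 'I_8}) : #|T| = 4%N -> #|iota8 T| = 3%N.
Proof.
have iota_D (B : {set 'I_8}) : label 8 \in B -> #|B| = 4%N ->
    #|B :\ label 8| = 3%N.
  by move=> B8 B4; move: B4; rewrite (cardsD1 (label 8)) B8 => -[].
move=> T4; rewrite /iota8; case: ifP => T8; first exact: iota_D.
by apply: iota_D; rewrite ?inE ?T8 // card_setC8 T4.
Qed.

(** A 4-subset contains [A], up to complement, exactly when it differs from [A]
    by one label. *)
Lemma mem_sigma (A t : {set 'I_8}) : #|A| = 3%N -> t \in triples7 ->
  (t \in sigma A) = (v_ [set label 8] + v_ t + v_ A \in points).
Proof.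
rewrite inE => A3 /andP[/eqP t3 t8]; apply/imsetP/imsetP => [[T]|[l _]].
  rewrite inE => /andP[sAT /eqP T4] Et; apply/imsetP; rewrite Et iota8_v v_D.
  by rewrite points_v card_symd T4 A3 (setIidPr sAT) A3.
move/addV_eq => E; have lA : l \notin A.
  by rewrite -(sing_point_triple _ A3) -E sing_point_triple.
have T4 : #|l |: A| = 4%N by rewrite cardsU1 lA A3.
have ET : v_ (l |: A) = v_ [set label 8] + v_ t.
  rewrite E v_D; congr v_; apply/setP=> i; rewrite !inE.
  by case: eqP => [->|] //=; rewrite (negPf lA).
exists (l |: A); first by rewrite inE subsetUr T4.
apply: triple_inj => //; first exact: card_iota8.
by apply: (addrI (v_ [set label 8])); rewrite iota8_v.
Qed.

Lemma mem_sigma_lines phi (A : {set 'I_8}) L :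
    line_identification phi -> #|A| = 3%N ->
  (L \in sigma_lines phi A) = (L \in pg_lines) && (psi phi L + v_ A \in points).
Proof.
move=> hphi A3; rewrite finset.in_set; apply: andb_id2l => hL.
rewrite mem_sigma //; have [t3 t8] := phi_triple hphi hL.
by rewrite inE t3 t8.
Qed.

Lemma psi_sigma_lines phi (A : {set 'I_8}) :
    line_identification phi -> #|A| = 3%N ->
  psi phi @: sigma_lines phi A = [set v_ [set l] + v_ A | l in ~: A].
Proof.
move=> hphi A3; apply/setP=> x; apply/imsetP/imsetP => [[L]|[l]].
  rewrite mem_sigma_lines // => /andP[hL /imsetP[l _ /addV_eq E]] ->.
  exists l => //; rewrite inE -(sing_point_triple _ A3) -E.
  exact: psi_sing.
rewrite inE -(sing_point_triple _ A3) => sx ->.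
have [L hL EL] := psi_surj hphi sx; exists L => //.
by rewrite mem_sigma_lines // hL EL addKV mem_points.
Qed.

Lemma sigma_lines_sub phi (A : {set 'I_8}) : sigma_lines phi A \subset pg_lines.
Proof. by apply/fintype.subsetP=> L; rewrite finset.in_set => /andP[]. Qed.

Lemma card_sigma_lines phi (A : {set 'I_8}) :
    line_identification phi -> #|A| = 3%N ->
  #|sigma_lines phi A| = 5%N.
Proof.
move=> hphi A3; have sub := fintype.subsetP (sigma_lines_sub phi A).
have <- : #|psi phi @: sigma_lines phi A| = #|sigma_lines phi A|.
  by apply: card_in_imset => L M /sub hL /sub hM; apply: psi_inj.
rewrite psi_sigma_lines // card_imset ?card_setC8 ?A3 //.
by move=> l m /addIr/point_inj.
Qed.

Lemma sigma_lines_disjoint phi (A B : {set 'I_8}) : line_identification phi ->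
    #|A| = 3%N -> #|B| = 3%N -> #|A :&: B| = 1%N ->
  [disjoint sigma_lines phi A & sigma_lines phi B].
Proof.
move=> hphi A3 B3 AB1; apply/pred0P=> L /=; apply/negP.
rewrite !mem_sigma_lines //; case/andP=> /andP[_ /imsetP[l _ El]].
case/andP=> _ /imsetP[m _ Em].
have := sing_points l m; rewrite -El -Em [psi phi L + v_ A]addrC -addrA addVK.
by rewrite sing_triples // AB1.
Qed.

(** Adding the label [l] to [A] gives a 4-subset; it contains [B] up to
    complement when [A] and [B] share two labels and [l] is the missing one, or
    when [A] and [B] are disjoint and [l] lies outside both. *)
Lemma near_both (A B : {set 'I_8}) l : #|A| = 3%N -> #|B| = 3%N ->
    #|A :&: B| != 3%N -> l \notin A ->
  (v_ [set l] + v_ A + v_ B \in points) =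
    (#|A :&: B| == (l \in B).*2).
Proof.
move=> A3 B3 n3 lA; rewrite !v_D points_v card_symd card_symd A3 B3 cards1 !inE.
have -> : #|[set l] :&: A| = 0%N.
  by apply/eqP; rewrite cards_eq0 setI_eq0 disjoints1.
have -> : #|symd [set l] A :&: B| = (#|A :&: B| + (l \in B))%N.
  have -> : symd [set l] A :&: B = (A :&: B) :|: ([set l] :&: B).
    apply/setP=> i; rewrite !inE; case: eqP => [->|_] /=; last by rewrite orbF.
    by rewrite (negPf lA).
  rewrite cardsU (_ : A :&: B :&: _ = set0) ?cards0 ?subn0; last first.
    by apply/setP=> i; rewrite !inE; have [->|_] := eqVneq i l;
      rewrite ?(negPf lA) ?andbF.
  congr addn; case: (boolP (l \in B)) => lB.
    by rewrite (setIidPl _) ?cards1 // sub1set.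
  by apply/eqP; rewrite cards_eq0 setI_eq0 disjoints1.
have := subset_leq_card (subsetIl A B); rewrite A3.
by case: (l \in B); case: #|_| n3 => [|[|[|[|]]]].
Qed.

Lemma triples_meet3 (A B : {set 'I_8}) : #|A| = 3%N -> #|B| = 3%N ->
  A != B -> #|A :&: B| != 3%N.
Proof.
move=> A3 B3; apply: contraNneq => AB3.
have EA : A :&: B = A by apply/eqP; rewrite eqEcard subsetIl AB3 A3.
have EB : A :&: B = B by apply/eqP; rewrite eqEcard subsetIr AB3 B3.
by rewrite -EA EB.
Qed.

(** Triples that share two labels lie in a common 4-subset, and disjoint triples
    are in opposite parts of a 4|4 partition; either way the spreads share a
    line. *)
Lemma sigma_lines_meet phi (A B : {set 'I_8}) : line_identification phi ->
    #|A| = 3%N -> #|B| = 3%N -> A != B ->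
  [disjoint sigma_lines phi A & sigma_lines phi B] -> #|A :&: B| = 1%N.
Proof.
move=> hphi A3 B3 nAB /pred0P disj; have n3 := triples_meet3 A3 B3 nAB.
have le3 := subset_leq_card (subsetIl A B); rewrite A3 in le3.
apply/eqP/negPn/negP => n1.
have [l lA near] : exists2 l, l \notin A & #|A :&: B| = (l \in B).*2.
  have [k2|k2] := eqVneq #|A :&: B| 2%N.
    have [l lBA] : exists l, l \in B :\: A.
      by apply/card_gt0P; rewrite cardsD setIC k2 B3.
    by move: lBA; rewrite inE => /andP[lA lB]; exists l; rewrite ?k2 ?lB.
  have k0 : #|A :&: B| = 0%N by move: le3 n3 n1 k2; case: #|_| => [|[|[|[|]]]].
  have [l] : exists l, l \in ~: (A :|: B).
    by apply/card_gt0P; rewrite card_setC8 cardsU A3 B3 k0.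
  by rewrite !inE negb_or => /andP[lA lB]; exists l; rewrite ?k0 ?(negPf lB).
have [|L hL EL] := psi_surj (x := v_ [set l] + v_ A) hphi.
  by rewrite sing_point_triple.
have := disj L; rewrite /= !mem_sigma_lines // hL EL addKV mem_points.
by rewrite near_both // near eqxx.
Qed.

(** Some label completes [A] to a 4-subset that neither contains nor avoids
    [B]: if [A] and [B] are disjoint a label of [B], otherwise a label outside
    both. *)
Lemma sigma_lines_inj phi (A B : {set 'I_8}) : line_identification phi ->
  #|A| = 3%N -> #|B| = 3%N -> sigma_lines phi A = sigma_lines phi B -> A = B.
Proof.
move=> hphi A3 B3 eAB; apply/eqP/negPn/negP => nAB.
have n3 := triples_meet3 A3 B3 nAB.
have [l lA far] : exists2 l, l \notin A & #|A :&: B| != (l \in B).*2.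
  have [k0|k0] := eqVneq #|A :&: B| 0%N.
    have [l lBA] : exists l, l \in B :\: A.
      by apply/card_gt0P; rewrite cardsD setIC k0 B3.
    by move: lBA; rewrite inE => /andP[lA lB]; exists l; rewrite ?k0 ?lB.
  have [l] : exists l, l \in ~: (A :|: B).
    apply/card_gt0P; rewrite card_setC8 subn_gt0 cardsU A3 B3.
    exact: leq_ltn_trans (leq_subr _ _) _.
  by rewrite !inE negb_or => /andP[lA lB]; exists l; rewrite // (negPf lB).
have [|L hL EL] := psi_surj (x := v_ [set l] + v_ A) hphi.
  by rewrite sing_point_triple.
have /setP/(_ L) := eAB; rewrite !mem_sigma_lines // hL EL addKV mem_points.
by rewrite near_both // (negPf far).
Qed.

(** * Spreads and packings *)

Lemma partition_of_card (T : finType) (P : {set {set T}}) (D : {set T}) n :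
    (0 < n)%N -> #|D| = (#|P| * n)%N -> {in P, forall B : {set T}, #|B| = n} ->
    {in P, forall B : {set T}, B \subset D} ->
    {in P &, forall B C : {set T}, B != C -> [disjoint B & C]} ->
  partition P D.
Proof.
move=> n0 cD Pn PD disjP; have tP : trivIset P by apply/trivIsetP.
have cP : #|cover P| = (#|P| * n)%N.
  by rewrite -(eqP tP) -sum_nat_const; apply: eq_bigr.
apply/and3P; split=> //.
  rewrite eqEcard cP cD leqnn andbT.
  by apply/bigcupsP.
by apply/negP => /Pn; rewrite cards0 => n_0; rewrite -n_0 in n0.
Qed.

(** Two lines in [sigma_lines phi A] differ from v_A by points, so their sum is
    a sum of two points and they do not meet; five disjoint lines use up the 15
    points. *)
Lemma sigma_lines_spread phi (A : {set 'I_8}) : line_identification phi ->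
  #|A| = 3%N -> sigma_lines phi A \in spreads.
Proof.
move=> hphi A3; have sub := fintype.subsetP (sigma_lines_sub phi A).
rewrite inE sigma_lines_sub (card_sigma_lines hphi A3) eqxx /=.
apply: (@partition_of_card _ _ _ 3) => //.
- by rewrite card_pg_points (card_sigma_lines hphi A3).
- by move=> L /sub/card_pg_line.
- by move=> L /sub/pg_line_sub.
move=> L M LA MA nLM; rewrite -setI_eq0; apply: negbNE.
rewrite (psi_meet hphi (sub _ LA) (sub _ MA) nLM).
move: LA MA; rewrite !mem_sigma_lines // => /andP[_ /imsetP[l _ /addV_eq ->]].
case/andP=> _ /imsetP[m _ /addV_eq ->].
by rewrite addrACA addVV addr0 sing_points.
Qed.

(** The lines of a spread are pairwise nonorthogonal singular vectors, so
    [nonorthogonal_quintuple] gives a vector near all of them; it is odd, and it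
    is not a point because a sum of two points is not singular. *)
Lemma spread_sigma_lines phi S : line_identification phi -> S \in spreads ->
  exists2 A : {set 'I_8}, #|A| = 3%N & S = sigma_lines phi A.
Proof.
move=> hphi; rewrite inE => /and3P[/fintype.subsetP sub /eqP S5].
case/and3P=> _ /trivIsetP disj _.
have [|x||z Sz] := @nonorthogonal_quintuple (map (psi phi) (enum S)).
- by rewrite size_map -cardE S5.
- by case/mapP=> L; rewrite mem_enum => /sub hL ->; apply: psi_sing.
- rewrite pairwise_map; apply: (@sub_in_pairwise _ (mem S) [rel x y | x != y]).
  + move=> L M LS MS /= nLM; apply/andP; split.
      by apply: contraNneq nLM => /(psi_inj hphi (sub L LS) (sub M MS)) ->.
    by rewrite -(psi_meet hphi (sub L LS) (sub M MS) nLM) negbK setI_eq0 disj.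
  + by apply/allP=> L; rewrite mem_enum.
  + by rewrite -uniq_pairwise enum_uniq.
have {}Sz L : L \in S -> psi phi L + z \in points.
  by move=> LS; apply: Sz; rewrite map_f // mem_enum.
have [L0 L0S] : exists L, L \in S by apply/card_gt0P; rewrite S5.
have sL0 := psi_sing hphi (sub L0 L0S).
have [l _ El] := imsetP (Sz L0 L0S).
have [|/imsetP[m _ Em]|[A A3 EA]] := odd_v (x := z).
- have := points_even l; rewrite -El even_v_add (sing_even sL0).
  by case: (z \in _).
- by move: sL0; rewrite (addV_eq El) Em sing_points.
exists A => //; apply/eqP; rewrite eqEcard S5 (card_sigma_lines hphi A3) andbT.
by apply/fintype.subsetP=> L LS; rewrite mem_sigma_lines // -EA sub // Sz.
Qed.

Lemma card_pg_lines phi : line_identification phi -> #|pg_lines| = 35%N.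
Proof.
move=> hphi; rewrite -card_sing -(card_in_imset (psi_inj hphi)).
apply: eq_card => x; rewrite inE; apply/imsetP/idP => [[L hL ->]|sx].
  exact: psi_sing.
by have [L hL <-] := psi_surj hphi sx; exists L.
Qed.

(** The triples of a Fano plane meet pairwise in one label, so their spreads are
    disjoint, and 7 * 5 = 35. *)
Lemma packing_of_fano_packing phi x : line_identification phi ->
  x \in fano_planes -> packing_of_fano phi x \in packings.
Proof.
move=> hphi /fano_meeting_once[[x3 x1] x7].
have c7 : #|packing_of_fano phi x| = 7%N.
  rewrite -x7; apply: card_in_imset => s t /x3 s3 /x3 t3.
  exact: sigma_lines_inj.
rewrite inE c7 eqxx /=; apply/andP; split.
  apply/fintype.subsetP=> _ /imsetP[A Ax ->].
  by apply: sigma_lines_spread; rewrite // x3.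
apply: (@partition_of_card _ _ _ 5) => //.
- by rewrite c7 (card_pg_lines hphi).
- by move=> _ /imsetP[A Ax ->]; rewrite card_sigma_lines // x3.
- by move=> _ /imsetP[A Ax ->]; apply: sigma_lines_sub.
move=> _ _ /imsetP[A Ax ->] /imsetP[B Bx ->] nAB.
apply: sigma_lines_disjoint hphi (x3 A Ax) (x3 B Bx) (x1 A B Ax Bx _).
by apply: contraNneq nAB => ->.
Qed.

Lemma packing_of_fano_inj phi : line_identification phi ->
  {in fano_planes &, injective (packing_of_fano phi)}.
Proof.
move=> hphi; have sub x y : x \in fano_planes -> y \in fano_planes ->
    packing_of_fano phi x = packing_of_fano phi y -> x \subset y.
  move=> /fano_meeting_once[[x3 _] _] /fano_meeting_once[[y3 _] _] Exy.
  apply/fintype.subsetP=> A Ax.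
  have : sigma_lines phi A \in packing_of_fano phi y by rewrite -Exy imset_f.
  by case/imsetP=> B By /(sigma_lines_inj hphi (x3 A Ax) (y3 B By)) ->.
move=> x y xF yF Exy; apply/eqP; rewrite eqEsubset !sub //.
Qed.

(** Conversely the seven triples of the spreads of a packing meet pairwise in
    one label, and these are Fano planes by [meeting_once_fano]. *)
Lemma packing_of_fano_surj phi P : line_identification phi -> P \in packings ->
  exists2 x, x \in fano_planes & packing_of_fano phi x = P.
Proof.
move=> hphi; rewrite inE => /and3P[/fintype.subsetP sub /eqP P7].
case/and3P=> _ /trivIsetP disj _.
pose x := [set A : {set 'I_8} | (#|A| == 3%N) && (sigma_lines phi A \in P)].
have x3 : triple_system x by move=> A; rewrite inE => /andP[/eqP].
have xP A : A \in x -> sigma_lines phi A \in P by rewrite inE => /andP[].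
have EP : packing_of_fano phi x = P.
  apply/setP=> S; apply/imsetP/idP => [[A /xP AP ->//]|SP].
  have [A A3 ES] := spread_sigma_lines hphi (sub S SP); exists A => //.
  by rewrite inE A3 eqxx -ES.
have inj : {in x &, injective (sigma_lines phi)}.
  by move=> A B /x3 A3 /x3 B3; apply: sigma_lines_inj.
exists x => //; apply: meeting_once_fano; last first.
  by rewrite -(card_in_imset inj) -/(packing_of_fano phi x) EP P7.
split=> // A B Ax Bx nAB.
apply: (sigma_lines_meet hphi (x3 A Ax) (x3 B Bx) nAB).
by apply: disj; rewrite ?xP //; apply: contraNneq nAB => /(inj A B Ax Bx) ->.
Qed.

Lemma set_bij_of (T1 T2 : finType) (A : {set T1}) (B : {set T2})
    (f : T1 -> T2) :
    {in A, forall x, f x \in B} -> {in A &, injective f} ->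
    (forall y, y \in B -> exists2 x, x \in A & f x = y) ->
  set_bij [set` A]%classic [set` B]%classic f.
Proof.
move=> fAB finj fsurj; split=> [x|x y /set_mem xA /set_mem yA|y] /=.
- exact: fAB.
- exact: finj.
- by move/fsurj=> [x xA <-]; exists x.
Qed.

Lemma packing_of_fano_bij phi : line_identification phi ->
  set_bij [set` fano_planes]%classic [set` packings]%classic
    (packing_of_fano phi).
Proof.
move=> hphi; apply: set_bij_of => [x|x y|P].
- exact: packing_of_fano_packing.
- exact: packing_of_fano_inj.
- exact: packing_of_fano_surj.
Qed.

Lemma lambdaM_bij phi : line_identification phi ->
  set_bij [set` packings]%classic [set` Omega_AM]%classic (lambdaM phi).
Proof.
move=> hphi; have fanoAM :
    set_bij [set` fano_planes]%classic [set` Omega_AM]%classic lambdaM_fano.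
  apply: set_bij_of lambdaM_fano_inj lambdaM_fano_surj.
  exact: lambdaM_fano_Omega_AM.
have fanoP := bijpinv_bij (fun=> set0) (packing_of_fano_bij hphi).
exact: set_bij_comp fanoP fanoAM.
Qed.

(** * Orthogonal tuples of roots *)

Lemma label_ord (i : 'I_8) : label i.+1 = i.
Proof. exact: inord_val. Qed.

Lemma label_eq i j : (0 < i <= 8)%N -> (0 < j <= 8)%N ->
  (label i == label j) = (i == j).
Proof.
case: i j => [|i] [|j] //= i8 j8.
by rewrite -val_eqE /= !inordK // eqSS.
Qed.

(** The half-sum and half-difference of the second and third simple roots are
    e_2 and e_1; the differences then give e_3 up to e_7, and the first simple
    root gives e_8. *)
Lemma simple_roots_span (R : realType) (a : 'rV[R]_8) :
  a \in <<simple_roots R>>%VS.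
Proof.
set X := <<_>>%VS; have simpleX k : (k < 8)%N -> (simple_roots R)`_k \in X.
  by move=> k8; apply/memv_span/mem_nth; rewrite size_tuple.
have halfX (u v : 'rV[R]_8) : u + v \in X -> v - u \in X ->
    (u \in X) && (v \in X).
  move=> uvX vuX.
  have -> : (u \in X) = (2^-1 *: ((u + v) - (v - u)) \in X).
    by congr (_ \in X); apply/rowP=> i; rewrite !mxE; lra.
  have -> : (v \in X) = (2^-1 *: ((u + v) + (v - u)) \in X).
    by congr (_ \in X); apply/rowP=> i; rewrite !mxE; lra.
  by apply/andP; split; apply: memvZ; [apply: memvB|apply: memvD].
have stepX (u v : 'rV[R]_8) : v \in X -> u - v \in X -> u \in X.
  by move=> vX uvX; rewrite -(subrK v u) memvD.
have /andP[e1 e2] : (e R 1 \in X) && (e R 2 \in X).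
  by apply: halfX; [exact: (simpleX 1%N)|exact: (simpleX 2%N)].
have e3 : e R 3 \in X by apply: stepX e2 _; apply: (simpleX 3).
have e4 : e R 4 \in X by apply: stepX e3 _; apply: (simpleX 4).
have e5 : e R 5 \in X by apply: stepX e4 _; apply: (simpleX 5).
have e6 : e R 6 \in X by apply: stepX e5 _; apply: (simpleX 6).
have e7 : e R 7 \in X by apply: stepX e6 _; apply: (simpleX 7).
have sX : \sum_(2 <= i < 8) e R i \in X.
  by rewrite big_nat; apply: memv_suml => -[|[|[|[|[|[|[|[|i]]]]]]]].
have e8 : e R 8 \in X.
  have /= a1 := simpleX 0%N isT.
  have : e R 1 + e R 8 \in X.
    rewrite -[_ + _]scale1r -(mulfV (x := 2 : R)) ?pnatr_eq0 // -scalerA memvZ //.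
    rewrite -(subrK (2^-1 *: (\sum_(2 <= i < 8) e R i)) (2^-1 *: _)).
    by rewrite memvD // memvZ.
  by rewrite addrC => /(fun h => rpredB h e1); rewrite addrK.
rewrite [a]row_sum_delta; apply: memv_suml => i _; apply: memvZ.
rewrite -(label_ord i); case: i => k.
by do 8?[case: k => [//|k]].
Qed.

(** The first simple root is the only one with a coordinate along e_8. *)
Lemma coord_simple_roots0 (R : realType) (a : 'rV[R]_8) :
  coord (simple_roots R) 0 a = 2 * a 0 (label 8).
Proof.
have e_lt8 k : (0 < k < 8)%N -> (e R k) 0 (label 8) = 0.
  case/andP=> k0 k8; rewrite mxE label_eq ?k0 1?ltnW //.
  by rewrite gtn_eqF // andbF.
have e8 : (e R 8) 0 (label 8) = 1 by rewrite mxE !eqxx.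
have simple_lt8 k : (0 < k < 8)%N -> ((simple_roots R)`_k) 0 (label 8) = 0.
  case: k => [|[|k]] //; first by rewrite /= mxE !e_lt8 ?addr0.
  do 6?[case: k => [_|k];
    first by rewrite /= mxE [X in _ + X]mxE !e_lt8 ?subrr].
  by [].
rewrite {2}(coord_span (simple_roots_span a)) summxE big_ord_recl.
rewrite big1 => [|i _].
  rewrite addr0 mxE /= mxE [X in X + _]mxE [X in _ + X]mxE [X in _ - X]mxE.
  rewrite summxE big_nat big1 => [|k /andP[k2 k8]]; last first.
    by rewrite e_lt8 // k8 ltnW.
  rewrite mxE e8 e_lt8 // add0r mulr0 subr0 mulr1 mulrCA mulfV ?mulr1 //.
  by rewrite pnatr_eq0.
by rewrite mxE simple_lt8 ?mulr0 // (ltn_ord (lift ord0 i)).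
Qed.

Definition half_vec (R : realType) (A : {set 'I_8}) : 'rV[R]_8 :=
  \row_i (if i \in A then 2^-1 else - 2^-1).

(** The e_8-coordinate of a root in [Psi] is 1/2, which excludes the integral
    roots. Sets of positive coordinates replace sets of negative ones; parity is
    unchanged because the dimension 8 is even. *)
Lemma PsiP (R : realType) (a : 'rV[R]_8) :
  reflect (exists A : {set 'I_8},
             [/\ label 8 \in A, ~~ odd #|A| & a = half_vec R A])
          (a \in @Psi R).
Proof.
rewrite inE; apply: (iffP andP) => [[]|[A [A8 oA ->]]].
  rewrite coord_simple_roots0 => /orP[].
    case/existsP=> i /existsP[j /existsP[s /existsP[t /andP[ij /eqP->]]]].
    rewrite !mxE !eqxx /=; have [Ei|_] := eqVneq (label 8) i.
      rewrite -Ei; have -> : (label 8 == j) = false.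
        by rewrite Ei -val_eqE /= ltn_eqF.
      by case: s; case: t; rewrite ?expr0 ?expr1 /= => /eqP E;
        exfalso; clear -E; lra.
    by case: (_ == j); case: s; case: t;
      rewrite ?expr0 ?expr1 /= => /eqP E; exfalso; clear -E; lra.
  case/existsP=> N /andP[oN /eqP Ea].
  have Eh : a = half_vec R (~: N).
    rewrite Ea; apply/rowP=> i; rewrite summxE (bigD1 i) //= big1 => [|j ji].
      rewrite !mxE !eqxx addr0 mulr1 inE.
      case: (i \in N); rewrite /= ?expr0 ?expr1.
        by rewrite mulN1r.
      by rewrite mul1r.
    by rewrite !mxE eqxx eq_sym (negPf ji) mulr0.
  rewrite Eh mxE; case: ifP => [N8 _|_ /eqP E]; last first.
    by exfalso; clear -E; lra.
  exists (~: N); split=> //.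
  by rewrite card_setC8 oddB ?card_le8.
split; last by rewrite coord_simple_roots0 mxE A8 mulfV ?pnatr_eq0.
apply/orP; right; apply/existsP; exists (~: A).
rewrite card_setC8 oddB ?card_le8 //= oA /=; apply/eqP/rowP=> i.
rewrite summxE (bigD1 i) //= big1 => [|j ji].
  rewrite !mxE !eqxx addr0 mulr1 inE; case: (i \in A); rewrite /= ?expr0 ?expr1.
    by rewrite mul1r.
  by rewrite mulN1r.
by rewrite !mxE eqxx eq_sym (negPf ji) mulr0.
Qed.

Lemma lambdaP_half_vec (R : realType) A : lambdaP (half_vec R A) = v_ A.
Proof.
congr v_; apply/setP=> i; rewrite inE mxE; case: (i \in A).
  by rewrite invr_gt0 ltr0n.
by rewrite oppr_gt0 invr_lt0 ltrn0.
Qed.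

(** The scalar product is (8 - 2d) / 4, where d counts the disagreements. *)
Lemma dot_half_vec (R : realType) A B :
  (dot (half_vec R A) (half_vec R B) == 0) = separated (v_ A) (v_ B).
Proof.
rewrite separated_v /dot.
have -> : \sum_i half_vec R A 0 i * half_vec R B 0 i
    = \sum_(i : 'I_8) (4^-1 - (i \in symd A B)%:R / 2).
  apply: eq_bigr => i _; rewrite !mxE inE.
  by case: (i \in A); case: (i \in B) => /=; lra.
rewrite big_split /= sumr_const card_ord sumrN -mulr_suml -natr_sum.
have -> : (\sum_(i : 'I_8) (i \in symd A B))%N = #|symd A B|.
  by rewrite -sum1_card [RHS]big_mkcond; apply: eq_bigr => i _; case: ifP.
rewrite -(eqr_nat R); apply/eqP/eqP => E; lra.
Qed.

(** The coordinates of [repr x] that agree with the last one form the same set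
    for both representatives, namely the part containing the last label; this
    makes [root_of] an inverse of [lambdaP]. *)
Definition root_of (R : realType) (x : V) : 'rV[R]_8 :=
  half_vec R [set i | repr x 0 i == repr x 0 (label 8)].

Lemma root_of_v (R : realType) (A : {set 'I_8}) : label 8 \in A ->
  root_of R (v_ A) = half_vec R A.
Proof.
move=> A8; congr half_vec; apply/setP=> i; rewrite inE.
have vE (j : 'I_8) : indic A 0 j = (j \in A)%:R by rewrite mxE.
rewrite /v_; case: (repr_piV (indic A)) => ->.
  by rewrite !vE A8; case: (i \in A).
by rewrite [LHS]/eq_op /= !mxE A8; case: (i \in A).
Qed.

Lemma v_with8 (x : V) : exists2 A : {set 'I_8}, label 8 \in A & x = v_ A.
Proof.
have [A ->] := v_surj x; have [A8|A8] := boolP (label 8 \in A).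
  by exists A.
by exists (~: A); rewrite ?v_setC // inE.
Qed.

Lemma root_of_Psi (R : realType) x : x \in LambdaP -> root_of R x \in @Psi R.
Proof.
have [A A8 ->] := v_with8 x; rewrite v_even => oA; apply/PsiP.
by exists A; rewrite root_of_v.
Qed.

Lemma root_ofK (R : realType) : cancel (@root_of R) (@lambdaP R).
Proof.
move=> x; have [A A8 ->] := v_with8 x.
by rewrite root_of_v ?lambdaP_half_vec.
Qed.

Lemma lambdaPK (R : realType) : {in @Psi R, cancel (@lambdaP R) (@root_of R)}.
Proof. by move=> a /PsiP[A [A8 _ ->]]; rewrite lambdaP_half_vec root_of_v. Qed.

Lemma lambdaP_even (R : realType) a : a \in @Psi R -> lambdaP a \in LambdaP.
Proof. by case/PsiP=> A [_ oA ->]; rewrite lambdaP_half_vec v_even. Qed.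

Lemma dot_lambdaP (R : realType) : {in @Psi R &, forall a b,
  (dot a b == 0) = separated (lambdaP a) (lambdaP b)}.
Proof.
move=> a b /PsiP[A [_ _ ->]] /PsiP[B [_ _ ->]].
by rewrite dot_half_vec !lambdaP_half_vec.
Qed.

Lemma mem_lambdaP_set (R : realType) (S : {fset 'rV[R]_8}) a :
    {subset S <= @Psi R} -> a \in @Psi R ->
  (lambdaP a \in lambdaP_set S) = (a \in S).
Proof.
move=> SPsi aPsi; apply/imsetP/idP => [[b _ E]|aS]; last by exists [` aS]%fset.
by rewrite -(lambdaPK aPsi) E lambdaPK ?SPsi ?(valP b).
Qed.

Lemma lambdaP_set_Omega_AP (R : realType) (S : {fset 'rV[R]_8}) :
  Omega_Psi S -> lambdaP_set S \in Omega_AP.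
Proof.
case=> SPsi S8 orth.
have injS : injective (fun a : S => lambdaP (val a)).
  move=> a b E; apply/val_inj; rewrite -(lambdaPK (SPsi _ (valP a))) E.
  by rewrite lambdaPK ?SPsi ?(valP b).
rewrite inE mem_Omega_A card_imset // -cardfE S8 eqxx andbT.
apply/andP; split; last first.
  apply/fintype.subsetP=> _ /imsetP[a _ ->]; exact/lambdaP_even/SPsi/valP.
apply/pairwise_separatedP => _ _ /imsetP[a _ ->] /imsetP[b _ ->] nab.
rewrite -separatedE -dot_lambdaP ?SPsi ?(valP a) ?(valP b) //.
rewrite orth ?(valP a) ?(valP b) //.
by apply: contraNneq nab => ->.
Qed.

Lemma lambdaP_set_surj (R : realType) (T : {set V}) : T \in Omega_AP ->
  exists2 S : {fset 'rV[R]_8}, Omega_Psi S & lambdaP_set S = T.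
Proof.
rewrite inE => /andP[TA /fintype.subsetP TP].
move: (TA); rewrite mem_Omega_A => /andP[/pairwise_separatedP sepT /eqP T8].
pose S : {fset 'rV[R]_8} := [fset root_of R x | x in T]%fset.
have SP a : a \in S -> exists2 x, x \in T & a = root_of R x.
  by case/imfsetP=> x /= xT ->; exists x.
have SPsi : {subset S <= @Psi R}.
  by move=> a /SP[x /TP xP ->]; apply: root_of_Psi.
exists S.
  split=> // [|a b /SP[x xT ->] /SP[y yT ->] nxy].
    by rewrite card_imfset /= -?cardE ?T8 //; apply: can_inj (root_ofK R).
  apply/eqP; rewrite dot_lambdaP ?root_of_Psi ?TP // !root_ofK separatedE.
  rewrite sepT //.
  by apply: contraNneq nxy => ->.
apply/setP=> x; have [xP|xP] := boolP (x \in LambdaP).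
  rewrite -{1}(root_ofK R x) mem_lambdaP_set ?root_of_Psi //.
  apply/idP/idP => [/SP[y yT /(can_inj (root_ofK R)) ->//]|xT].
  by apply/imfsetP; exists x.
apply/idP/idP => [/imsetP[a _ E]|/TP xP'].
  by move: xP; rewrite E lambdaP_even ?SPsi ?(valP a).
by rewrite xP' in xP.
Qed.

Lemma lambdaP_set_bij (R : realType) :
  set_bij (@Omega_Psi R) [set` Omega_AP]%classic (@lambdaP_set R).
Proof.
split=> [S|S T /set_mem[SPsi _ _] /set_mem[TPsi _ _] E|T].
- exact: lambdaP_set_Omega_AP.
- apply/fsetP=> a; have [aPsi|aPsi] := boolP (a \in @Psi R).
    by rewrite -!mem_lambdaP_set // E.
  by apply/idP/idP => [/SPsi|/TPsi] aP; rewrite aP in aPsi.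
- by move=> /(@lambdaP_set_surj R)[S SO <-]; exists S.
Qed.

(** * Passing from roots to packings *)

(** Translation preserves sums of two vectors, hence separation, and a point is
    odd, so the two cosets of [LambdaP] are exchanged. *)
Lemma t8_imset_bij :
  set_bij [set` Omega_AP]%classic [set` Omega_AM]%classic (fun S => t8 @: S).
Proof.
have t8_Omega (S : {set V}) : (t8 @: S \in Omega_A) = (S \in Omega_A).
  rewrite !mem_Omega_A card_imset; last exact: inv_inj t8K.
  congr (_ && _); apply/pairwise_separatedP/pairwise_separatedP => sepS x y.
    move=> xS yS nxy; have := sepS (t8 x) (t8 y).
    rewrite !imset_f // (inj_eq (inv_inj t8K)) nxy /t8 addrACA addVV addr0.
    by apply.
  case/imsetP=> {}x xS -> /imsetP[{}y yS ->].
  rewrite (inj_eq (inv_inj t8K)) => nxy.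
  by rewrite /t8 addrACA addVV addr0 sepS.
have t8_even x : (t8 x \in LambdaP) = (x \notin LambdaP).
  by rewrite /t8 even_v_add points_even; case: (x \in LambdaP).
have t8KS : involutive (fun S : {set V} => t8 @: S).
  by move=> S; rewrite -imset_comp (eq_imset _ t8K) imset_id.
have t8_sub (S : {set V}) : (t8 @: S \subset LambdaM) = (S \subset LambdaP).
  apply/fintype.subsetP/fintype.subsetP => sub x.
    move=> xS; have := sub (t8 x); rewrite inE t8_even negbK; apply.
    exact: imset_f.
  by case/imsetP=> y /sub yP ->; rewrite inE t8_even negbK.
apply: set_bij_of => [S|S T _ _|S].
- rewrite (mem_Omega_in LambdaP) => /andP[SA SP].
  by rewrite (mem_Omega_in LambdaM) t8_Omega SA t8_sub.
- by move=> E; apply: (inv_inj t8KS).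
- rewrite (mem_Omega_in LambdaM) => /andP[SA SM].
  exists (t8 @: S); last exact: t8KS.
  by rewrite (mem_Omega_in LambdaP) t8_Omega SA -t8_sub t8KS.
Qed.

Lemma enum_index_bij (T : finType) (A : {set T}) :
  set_bij [set` A]%classic `I_#|A|%classic (fun x => index x (enum A)).
Proof.
split=> [x|x y|k] /=.
- by rewrite cardE index_mem mem_enum.
- move=> /set_mem xA /set_mem yA E.
  rewrite -(nth_index x (s := enum A) (x := x)) ?mem_enum // E.
  by rewrite nth_index ?mem_enum.
rewrite cardE => kA; have x0 : T by case: (enum A) kA.
exists (nth x0 (enum A) k); last by rewrite index_uniq ?enum_uniq.
by rewrite /= -mem_enum mem_nth.
Qed.

Theorem theorem2p9 (R : realType) :
  [/\ [/\ #|max_totally_singular| = 30%N,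
          Omega_A = [set cosetV x W | x in [set: V], W in max_totally_singular]
        & forall S, S \in Omega_A -> #|S| = 8%N],
      [/\ #|Omega_A| = 480%N, #|Omega_AP| = 240%N, #|Omega_AM| = 240%N,
          Omega_A = Omega_AP :|: Omega_AM
        & [disjoint Omega_AP & Omega_AM]],
      forall phi : {set 'rV['F_2]_4} -> {set 'I_8}, line_identification phi ->
        set_bij [set` packings]%classic [set` Omega_AM]%classic (lambdaM phi),
      set_bij (@Omega_Psi R) [set` Omega_AP]%classic (@lambdaP_set R)
    & (@Omega_Psi R #= `I_240)%card /\
      forall phi : {set 'rV['F_2]_4} -> {set 'I_8}, line_identification phi ->
        set_bij (@Omega_Psi R) [set` packings]%classic
          (fun S => lambdaM_inv phi (t8 @: lambdaP_set S))].
Proof.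
have cAP := card_Omega_AP; have cAM := card_Omega_AM.
split.
- split; [exact: card_max_ts|exact: Omega_A_cosets|move=> S].
  by rewrite mem_Omega_A => /andP[_ /eqP].
- split=> //; [|exact: Omega_A_split|exact: Omega_A_disjoint].
  rewrite Omega_A_split cardsU disjoint_setI0 ?Omega_A_disjoint //.
  by rewrite cards0 cAP cAM.
- exact: lambdaM_bij.
- exact: lambdaP_set_bij.
split=> [|phi hphi].
  rewrite -cAP; apply/card_set_bijP.
  by eexists; apply: set_bij_comp (lambdaP_set_bij R) (enum_index_bij _).
have t8_lambdaP := set_bij_comp (lambdaP_set_bij R) t8_imset_bij.
exact: set_bij_comp t8_lambdaP (bijpinv_bij _ (lambdaM_bij hphi)).
Qed.
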